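(* Let $d=1$ and let $F$ be as described in the context. Assume: 1. $f(y|x)$ is continuous in $y$ in the interior of the support of $f(y|x)$ for all $x\in X$. 2. There exists $\overline{f}<\infty$ such that $f(y|x)\le\overline{f}$ for all $(y,x)$. 3. The support of $f(\cdot|x)$ is a finite interval $[a(x),b(x)]$, where $a(x)$ and $b(x)$ are square integrable. Also, for some $\underline{f}\in(0,1)$, a positive integer $n$, and $a(x)\le a_1(x)\le b_1(x)\le b(x)$: $f(y|x)\ge\underline{f}$ on $[a_1(x),b_1(x)]$; $f(y|x)\ge\underline{f}\cdot[y-a(x)]^n$ on $(a(x),a_1(x))$; and $f(y|x)\ge\underline{f}\cdot[b(x)-y]^n$ on $(b_1(x),b(x))$. 4. There exists $r>0$ such that $f(\cdot|x)$ is nondecreasing on $(a(x),a_1(x)+r/2)$ and nonincreasing on $(b_1(x)-r/2,b(x))$ for all $x\in X$. 5. $F^{-1}(p|x)$ is continuous in $x$ for all $p\in[0,1]$, and $X$ is compact. Then there exist polynomials $P_j^m(x)$ in $x$ ($m\ge1$, $j=1,\dots,m$) such that, with $p_m=1/m$ and $$p(y|x,\mathcal{M}_5)=\sum_{j=1}^mp_m\,\phi\big(y,P_j^m(x),p_m^{1/[4(n+1)]}\big),$$ $d_{\mathrm{KL}}(F,\mathcal{M}_5)\to0$ as $m\to\infty$.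
   Context: $F$ is a probability distribution on $Y\times X$, $Y\subset\mathbb{R}$, $X\subset\mathbb{R}^{d_x}$. The conditional distribution of $y$ given $x$ has a density $f(y|x)$ with respect to Lebesgue measure; the marginal of $x$ has a density $f(x)$ with respect to some generic measure, and square integrability is with respect to the marginal distribution of $x$. $F^{-1}(p|x)$ is the quantile function of the conditional distribution of $y$ given $x$. $\phi(y,\mu,\sigma)$ is the density at $y$ of the normal distribution with mean $\mu$ and standard deviation $\sigma$. For a model $\mathcal{M}$ with conditional density $p(y|x,\mathcal{M})$, $$d_{\mathrm{KL}}(F,\mathcal{M})=\int\log\frac{f(y|x)}{p(y|x,\mathcal{M})}\,F(dy,dx).$$ *)

(* Defs.v *)
From HB Require Import structures.
From mathcomp Require Import all_boot all_order all_algebra.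
From mathcomp Require Import all_classical all_reals all_analysis.
(* mpoly is deliberately not imported: its notations clash with those of
   mathcomp-analysis. *)
From mathcomp Require mpoly.

Set Implicit Arguments.
Unset Strict Implicit.
Unset Printing Implicit Defensive.

Import Order.TTheory GRing.Theory Num.Theory.
Import numFieldNormedType.Exports.

Local Open Scope classical_set_scope.
Local Open Scope ring_scope.

(* R^n with its Borel sigma-algebra; convertible to 'rV[R]_n, which carries the
   topology but no measurable structure. *)
Definition borel_rV (R : realType) (n : nat) :=
  g_sigma_algebraType (@open 'rV[R]_n).

(* Joint laws of (y, x): the response y is the first component, the covariate x
   the second.  A conditional density f(y|x) is written f x y. *)
Section joint_law.
Variables (R : realType) (n : nat).
Variable F : probability (measurableTypeR R * borel_rV R n)%type R.

Definition marginal_x : set (borel_rV R n) -> \bar R :=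
  pushforward F (snd : measurableTypeR R * borel_rV R n -> borel_rV R n).

Definition marginal_density (X : set (borel_rV R n))
    (nu : {measure set (borel_rV R n) -> \bar R}) (fX : 'rV[R]_n -> R) : Prop :=
  [/\ measurable_fun X (fX : borel_rV R n -> measurableTypeR R),
      forall x, X x -> 0 <= fX x &
      forall C : set (borel_rV R n), measurable C ->
        marginal_x C = (\int[nu]_(x in X `&` C) (fX x)%:E)%E].

(* f x is the density on R of the law of y given x, extended by 0 outside Y;
   values of f at points x outside X are irrelevant. *)
Definition conditional_density (Y : set (measurableTypeR R))
    (X : set (borel_rV R n)) (f : 'rV[R]_n -> R -> R) : Prop :=
  [/\ measurable_fun (setT `*` X)
        (fun z : measurableTypeR R * borel_rV R n => f z.2 z.1),
      forall x y, X x -> 0 <= f x y,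
      forall x y, X x -> ~ Y y -> f x y = 0,
      forall x, X x -> (\int[lebesgue_measure]_y (f x y)%:E = 1)%E &
      forall (B : set (measurableTypeR R)) (C : set (borel_rV R n)),
        measurable B -> measurable C ->
        F (B `*` C) = (\int[marginal_x]_(x in X `&` C)
                        \int[lebesgue_measure]_(y in B) (f x y)%:E)%E].

Definition square_integrable (X : set (borel_rV R n)) (a : 'rV[R]_n -> R) :=
  measurable_fun X (a : borel_rV R n -> measurableTypeR R) /\
  marginal_x.-integrable X (fun x => (a x ^+ 2)%:E).

(* The integrand at points with f x y = 0 is a junk value (ln 0 = 0), but these
   points form an F-null set.  The integral is in \bar R and may be +oo. *)
Definition kl_divergence (Y : set (measurableTypeR R)) (X : set (borel_rV R n))
    (f p : 'rV[R]_n -> R -> R) : \bar R :=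
  (\int[F]_(z in Y `*` X) (ln (f z.2 z.1 / p z.2 z.1))%:E)%E.

End joint_law.

Section conditional_law.
Variables (R : realType) (n : nat) (f : 'rV[R]_n -> R -> R).

Definition density_support (x : 'rV[R]_n) : set R :=
  closure [set y | f x y != 0].

Definition conditional_cdf (x : 'rV[R]_n) (y : R) : R :=
  \int[lebesgue_measure]_(u in `]-oo, y]) f x u.

(* For 0 < p <= 1 this is the usual inf {y | p <= F(y|x)}, since that infimum
   lies in the support; the restriction to the support only matters for p = 0,
   where it yields the left end point of the support instead of -oo. *)
Definition quantile (p : R) (x : 'rV[R]_n) : R :=
  inf [set y | density_support x y /\ p <= conditional_cdf x y].

End conditional_law.

Definition normal_mixture_density (R : realType) (dx m : nat)
    (P : 'I_m -> mpoly.mpoly dx R) (s : R) (x : 'rV[R]_dx) (y : R) : R :=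
  \sum_(j < m)
    m%:R^-1 * normal_pdf (mpoly.meval (fun i => x ord0 i) (P j)) s y.

(* Main.v *)
Require Import Defs.
From HB Require Import structures.
From mathcomp Require Import all_boot all_order all_algebra.
From mathcomp Require Import -(notations) mpoly.
From mathcomp Require Import all_classical all_reals all_analysis measurable_realfun.
From mathcomp Require Import ring lra.

Set Implicit Arguments.
Unset Strict Implicit.
Unset Printing Implicit Defensive.

Import Order.TTheory GRing.Theory Num.Theory.
Import numFieldNormedType.Exports.

Local Open Scope classical_set_scope.
Local Open Scope ring_scope.

(** Write [s] for the common standard deviation of the mixture with [m]
    components, so that [1 / m = s ^+ (4 * n.+1)], and choose the polynomials
    [P_j] so that [P_j x] is within [1 / m] of the conditional quantile of order
    [j / m], for [1 <= j <= m] and uniformly in [x]; this is possible by the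
    Stone-Weierstrass theorem, as the quantiles are continuous on the compact set
    [X] ([continuous_mpoly_approximable]).

    Consecutive quantiles cut the support into cells of mass [1 / m], so the
    mixture is a Riemann sum for the convolution of [f x] with the centred normal
    density of deviation [s].  The normal density is Lipschitz in its mean with
    constant [1 / s ^+ 2], so the two differ by at most
    [(b x - a x + 1) / (m * s ^+ 2)] ([mixture_smooth]).  Since [a] and [b] are
    the quantiles of order [0] and [1], they are bounded on [X], and this error is
    [O(s ^+ (4 * n + 2))] uniformly in [x] and [y].

    The convolution tends to [f x y] at every interior point of the support
    ([smooth_cvg]), and it lies below the upper bound of [f].  It also has two
    lower bounds, of order [f x y] and of order [s ^+ n] ([smooth_lower_bound]):
    from any interior point one can move by [s] in at least one direction along
    which the density does not fall below a fixed fraction of [f x y], and on the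
    second half of that way it is at least [fmin * (s / 2) ^+ n]
    ([one_sided_lower_bound]).  The bound of order [s ^+ n] dominates the Riemann sum error.
    The mixture [p] therefore converges to [f] in the interior of the support and
    satisfies [c * f x y <= p x y <= K] there, with [c > 0] and [K] independent of
    [x], [y] and [m], for [m] large ([mixture_estimates]).

    Consequently [`|ln (f / p)|] is at most a constant plus [2 * `|ln f|], which is
    integrable under the joint law: there it is integrated against [f], and
    [t * ln t] is bounded on bounded sets ([integrable_log_density]).  Dominated
    convergence concludes ([kl_divergence_cvg0]). *)

(** * Uniform approximation by polynomials on a compact set *)

Section polynomial_approximation.
Variables (R : realType) (n : nat).
Implicit Types (p q : mpoly.mpoly n R) (x : 'rV[R]_n) (X : set 'rV[R]_n).
Implicit Types g h : 'rV[R]_n -> R.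

Definition mpoly_fun p x : R := mpoly.meval (fun i => x ord0 i) p.

Lemma continuous_mpoly_fun p : continuous (mpoly_fun p).
Proof.
elim/mpoly.mpolyind: p => [|c m p _ _ IH] x.
  rewrite (_ : mpoly_fun 0 = cst 0); first exact: cst_continuous.
  by apply/funext => y; rewrite /mpoly_fun mpoly.meval0.
pose G (i : 'I_n) (y : 'rV[R]_n) : R := y ord0 i ^+ m i.
have cG : continuous (fun y => \prod_(i < n) G i y).
  apply: (@continuous_big R _ *%R 1 xpredT) => [|i _ y].
    exact: mul_continuous.
  apply: (@continuous_comp _ _ _ (fun z : 'rV[R]_n => z ord0 i)
      (fun t : R => t ^+ m i) y); first exact: coord_continuous.
  exact: exprn_continuous.
rewrite (_ : mpoly_fun _ =
    (cst c \* (fun y => \prod_(i < n) G i y)) \+ mpoly_fun p); last first.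
  apply/funext => y; rewrite /mpoly_fun mpoly.mevalD mpoly.mevalZ.
  by rewrite mpoly.mevalX.
apply: continuousD; last exact: IH.
by apply: continuousM; [exact: cst_continuous|exact: cG].
Qed.

Definition mpoly_approximable X g :=
  forall e : R, 0 < e ->
    exists p, forall x, X x -> `|mpoly_fun p x - g x| <= e.

(** The classical iteration for the square root of [t ^+ 2]: it is polynomial in
    [t], and its error [e] for [`|t| <= 1] satisfies
    [e' <= e * (1 - e / 2)]. *)
Fixpoint abs_approx (t : R) k : R :=
  if k is k'.+1 then
    abs_approx t k' + 2^-1 * (t ^+ 2 - abs_approx t k' ^+ 2)
  else 0.

(** The recursion on the error preserves the bound [e_k <= 2 / (k + 2)].  The
    absolute value is a separate variable [s], so that the statement is
    polynomial. *)
Lemma abs_approxP (t s : R) k : 0 <= s <= 1 -> t ^+ 2 = s ^+ 2 ->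
  0 <= abs_approx t k <= s /\ (s - abs_approx t k) * k.+2%:R <= 2.
Proof.
move=> /andP[s0 s1] ts; elim: k => [|k [/andP[]]] /=.
  by rewrite lexx s0 subr0; split => //; lra.
rewrite ts; move: (abs_approx t k) => u u0 us; rewrite -[k.+3%:R]natr1.
rewrite -[k.+2%:R]natr1 -[k.+1%:R]natr1; have : 0 <= k%:R :> R by [].
move: (k%:R) => K K0 H; split.
  have : 0 <= (s - u) * (s + u) by apply: mulr_ge0; lra.
  have : 0 <= (s - u) * (2 - (s + u)) by apply: mulr_ge0; lra.
  by move=> ? ?; apply/andP; split; lra.
pose e := s - u.
have -> : (s - (u + 2^-1 * (s ^+ 2 - u ^+ 2))) = e * (1 - (s + u) / 2).
  by rewrite /e; field.
have e0 : 0 <= e by rewrite /e; lra.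
have H1 : e * (1 - (s + u) / 2) <= e * (1 - e / 2).
  by apply: ler_wpM2l => //; rewrite /e; lra.
apply: (@le_trans _ _ (e * (1 - e / 2) * (K + 1 + 1 + 1))).
  by apply: ler_wpM2r => //; lra.
have {}H : e * (K + 1 + 1) <= 2 by [].
have {H1 us u0} e1 : e <= 1 by rewrite /e; lra.
clearbody e.
(* with z = 2 - e c, the claim is a polynomial inequality in z and c *)
set c := K + 1 + 1 in H *.
have c2 : 2 <= c by rewrite /c; lra.
clearbody c.
have [z zE] : exists z, 2 - e * c = z by eexists.
have z0 : 0 <= z by rewrite -zE; lra.
suff : e * (1 - e / 2) * (c + 1) * c * c <= 2 * c * c.
  by rewrite ler_pM2r ?ler_pM2r; lra.
have -> : e * (1 - e / 2) * (c + 1) * c * c = (e * c) * (c - (e * c) / 2) * (c + 1).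
  by field.
have -> : e * c = 2 - z by lra.
have : 0 <= z * c by nra.
have : 0 <= z * z * c by nra.
nra.
Qed.

Lemma mpoly_approximable_abs X p : compact X ->
  mpoly_approximable X (fun x => `|mpoly_fun p x|).
Proof.
move=> cX e e0.
have [B [B0 pB]] : exists B, 0 < B /\ forall x, X x -> `|mpoly_fun p x| <= B.
  have /continuous_compact/(_ cX)/compact_bounded[N [Nr NB]] :
    {within X, continuous (mpoly_fun p)}.
    exact/continuous_subspaceT/continuous_mpoly_fun.
  exists (`|N| + 1); split => [|x Xx]; first by rewrite ltr_pwDr.
  apply: (NB (`|N| + 1)); last by exists x.
  by rewrite (le_lt_trans (ler_norm N))// ltrDl.
have iter k : exists q, forall x, mpoly_fun q x = abs_approx (mpoly_fun p x / B) k.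
  elim: k => [|k [q IH]].
    by exists 0 => x; rewrite /mpoly_fun mpoly.meval0.
  exists (q + 2^-1 *: ((B^-1 *: p) ^+ 2 - q ^+ 2)) => x /=.
  rewrite -IH /mpoly_fun !(mpoly.mevalD, mpoly.mevalZ, mpoly.mevalN).
  by rewrite !expr2 !mpoly.mevalM !mpoly.mevalZ [_ / B]mulrC.
have [k kP] : exists k, 2 * B / e <= k%:R.
  exists (Num.bound (2 * B / e)); apply/ltW/archi_boundP.
  by rewrite divr_ge0 ?mulr_ge0 ?ltW.
have [q qE] := iter k; exists (B *: q) => x Xx.
rewrite /mpoly_fun mpoly.mevalZ -!/(mpoly_fun _ _) qE.
have := @abs_approxP (mpoly_fun p x / B) (`|mpoly_fun p x| / B) k.
set u := abs_approx _ _; set t := mpoly_fun p x.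
have t1 : 0 <= `|t| / B <= 1.
  by rewrite divr_ge0 ?(ltW B0)//= ler_pdivrMr// mul1r pB.
move=> /(_ t1); rewrite !expr_div_n real_normK ?num_real// => /(_ erefl).
move=> [/andP[u0 u1] u2].
have -> : B * u - `|t| = - (B * (`|t| / B - u)) by field; rewrite gt_eqF.
rewrite normrN ger0_norm ?mulr_ge0 ?subr_ge0 ?(ltW B0)//.
have {}u2 : (`|t| / B - u) * k%:R <= 2.
  apply: le_trans u2; rewrite ler_wpM2l ?subr_ge0// ler_nat.
  by rewrite -addn2 leq_addr.
have : B * ((`|t| / B - u) * (2 * B / e)) <= B * 2.
  rewrite ler_pM2l//; apply: le_trans u2.
  by rewrite ler_wpM2l ?subr_ge0.
have -> : B * ((`|t| / B - u) * (2 * B / e)) =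
    B * (`|t| / B - u) / e * (B * 2) by field; rewrite !gt_eqF.
by rewrite ger_pMl ?mulr_gt0// ler_pdivrMr// mul1r.
Qed.

Lemma mpoly_approximable_min X g h : compact X ->
  mpoly_approximable X g -> mpoly_approximable X h ->
  mpoly_approximable X (fun x => Num.min (g x) (h x)).
Proof.
move=> cX ag ah e e0; have e4 : 0 < e / 4 by lra.
have [p pg] := ag _ e4; have [q qh] := ah _ e4.
have [s sP] := @mpoly_approximable_abs X (p - q) cX _ e4.
exists (2^-1 *: (p + q - s)) => x Xx; move: (pg x Xx) (qh x Xx) (sP x Xx).
rewrite /mpoly_fun mpoly.mevalZ !mpoly.mevalB mpoly.mevalD -!/(mpoly_fun _ _).
move: (mpoly_fun p x) (mpoly_fun q x) (mpoly_fun s x) (g x) (h x).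
move=> a b c u v; rewrite !ler_distl.
have [ab|ab] := ger0P (a - b); have [uv|uv] := leP u v;
  move=> /andP[? ?] /andP[? ?] /andP[? ?]; apply/andP; split; lra.
Qed.

Lemma mpoly_approximable_bigmin X (I : Type) (s : seq I) g (h : I -> mpoly.mpoly n R) :
  compact X -> mpoly_approximable X g ->
  mpoly_approximable X
    (fun x => foldr (fun i t => Num.min (mpoly_fun (h i) x) t) (g x) s).
Proof.
move=> cX ag; elim: s => [|i s IH] //=.
apply: mpoly_approximable_min => // e e0; exists (h i) => x _.
by rewrite subrr normr0 ltW.
Qed.

(** A continuous function on a compact set is the infimum of the paraboloids
    above it: the polynomial [g z + e + L * sum_i (x_i - z_i) ^+ 2] lies above [g]
    on [X] as soon as [L] is large, and is close to [g] near [z].  By compactness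
    the minimum of finitely many of them is uniformly close to [g]. *)
Lemma continuous_mpoly_approximable X g : compact X ->
  {within X, continuous g} -> mpoly_approximable X g.
Proof.
move=> cX cg.
have [B [B0 gB]] : exists B, 0 < B /\ forall x, X x -> `|g x| <= B.
  have /compact_bounded[N [Nr NB]] := continuous_compact cg cX.
  exists (`|N| + 1); split => [|x Xx]; first by rewrite ltr_pwDr.
  apply: (NB (`|N| + 1)); last by exists x.
  by rewrite (le_lt_trans (ler_norm N))// ltrDl.
have gnear z d : X z -> 0 < d ->
    \forall x \near z, X x -> `|g x - g z| < d.
  move=> Xz d0; have /subspace_continuousP/(_ z Xz) := cg.
  move=> /cvgrPdist_lt /(_ d d0); rewrite near_withinE.
  by apply: filterS => x /[apply]; rewrite distrC.
have above e : 0 < e -> forall z, exists p,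
    X z -> [/\ forall x, X x -> g x <= mpoly_fun p x &
                \forall x \near z, X x -> mpoly_fun p x < g x + e].
  move=> e0 z; have [Xz|nXz] := pselect (X z); last by exists 0.
  have e2 : 0 < e / 2 by lra.
  have /nbhs_ballP[d /= d0 dP] := gnear z (e / 4) Xz ltac:(lra).
  (* with the coefficient 2 B / d ^+ 2 the paraboloid gains at least 2 B, which
     bounds the oscillation of g, at distance d from z *)
  pose sq := \sum_(i < n) (mpoly.mpolyX R (mpoly.mnm1 i) -
                           mpoly.mpolyC n (z ord0 i)) ^+ 2.
  have sqE x : mpoly_fun sq x = \sum_(i < n) (x ord0 i - z ord0 i) ^+ 2.
    rewrite /mpoly_fun /sq raddf_sum; apply: eq_bigr => i _ /=.
    by rewrite expr2 mpoly.mevalM mpoly.mevalB mpoly.mevalXU mpoly.mevalC expr2.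
  pose p := mpoly.mpolyC n (g z + e / 4) + (2 * B / d ^+ 2) *: sq.
  have pE x : mpoly_fun p x = g z + e / 4 + 2 * B / d ^+ 2 * mpoly_fun sq x.
    by rewrite /p /mpoly_fun mpoly.mevalD mpoly.mevalZ mpoly.mevalC.
  have L0 : 0 <= 2 * B / d ^+ 2 by rewrite divr_ge0 ?mulr_ge0 ?exprn_ge0 ?ltW.
  have sq0 x : 0 <= mpoly_fun sq x.
    by rewrite sqE sumr_ge0// => i _; exact: sqr_ge0.
  exists p => _; split => [x Xx|].
    rewrite pE.
    have [zx|] := pselect (ball z d x).
      have := dP x zx Xx; rewrite ltr_distl => /andP[_ gx].
      have := mulr_ge0 L0 (sq0 x); lra.
    move=> nzx.
    have [i di] : exists i, d <= `|x ord0 i - z ord0 i|.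
      apply: contrapT => /forallNP nd; apply: nzx.
      split => // i j; rewrite (ord1 i) /ball/= distrC ltNge.
      by apply/negP; exact: nd.
    have dsq : d ^+ 2 <= mpoly_fun sq x.
      rewrite sqE (bigD1 i)//= -[leLHS]addr0 lerD//.
        rewrite -[leRHS]real_normK ?num_real// lerXn2r ?nnegrE//.
        exact: ltW.
      by rewrite sumr_ge0// => j _; exact: sqr_ge0.
    have : 2 * B <= 2 * B / d ^+ 2 * mpoly_fun sq x.
      rewrite -[leLHS](@divfK _ (d ^+ 2)) ?gt_eqF ?exprn_gt0//.
      exact: ler_wpM2l.
    have := gB x Xx; have := gB z Xz; rewrite !ler_norml.
    by move=> /andP[? ?] /andP[? ?]; lra.
  have pz : mpoly_fun p z = g z + e / 4.
    rewrite pE sqE big1 ?mulr0 ?addr0// => i _.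
    by rewrite subrr expr0n.
  have := gnear z (e / 4) Xz ltac:(lra).
  have /cvgrPdist_lt/(_ (e / 4) ltac:(lra)) := @continuous_mpoly_fun p z.
  apply: filterS2 => x px gx Xx; move: px (gx Xx).
  by rewrite pz !ltr_distl => /andP[? ?] /andP[? ?]; lra.
move=> e e0; have e2 : 0 < e / 2 by lra.
have [Pz PzP] := choice (above _ e2).
have := cX; rewrite compact_cover => /(_ _ X
  (fun z => (interior [set x | X x -> mpoly_fun (Pz z) x < g x + e / 2]))).
case=> [z _|x Xx|D DX XD].
- exact: open_interior.
- by exists x => //; have [_] := PzP x Xx.
have Dg z : z \in finmap.enum_fset D -> forall x, X x -> g x <= mpoly_fun (Pz z) x.
  by move=> zD; have [|+ _] := PzP z; first by have := DX z zD; rewrite inE.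
(* the empty minimum is the upper bound B of g *)
have [q qP] := @mpoly_approximable_bigmin X _ (finmap.enum_fset D)
  (cst B) Pz cX ltac:(by move=> d d0; exists (mpoly.mpolyC n B) => x _;
    rewrite /mpoly_fun mpoly.mevalC subrr normr0 ltW) _ e2.
exists q => x Xx; have := qP x Xx.
have lower (s : seq 'rV[R]_n) : {subset s <= finmap.enum_fset D} ->
    g x <= foldr (fun i t => Num.min (mpoly_fun (Pz i) x) t) B s.
  elim: s => [_|z s IH sD] /=.
    by have := gB x Xx; rewrite ler_norml => /andP[].
  rewrite le_min Dg ?IH// => [i si|].
    by apply: sD; rewrite inE si orbT.
  by apply: sD; rewrite inE eqxx.
have upper (s : seq 'rV[R]_n) z : z \in s ->
    foldr (fun i t => Num.min (mpoly_fun (Pz i) x) t) B s <= mpoly_fun (Pz z) x.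
  elim: s => //= z' s IH; rewrite inE => /predU1P[->|/IH {}IH].
    by rewrite ge_min lexx.
  by rewrite ge_min IH orbT.
have [z zD /interior_subset/(_ Xx) zx] := XD x Xx.
have := upper _ z zD; have := lower (finmap.enum_fset D) ltac:(by []).
move: (foldr _ _ _) => t; rewrite !ler_distl => ? ? /andP[? ?].
by apply/andP; split; lra.
Qed.

End polynomial_approximation.

(** * Elementary bounds on the normal density *)

Section normal_bounds.
Variable R : realType.
Implicit Types (m s t y u v : R).

Definition gauss t : R := expR (- t ^+ 2 / 2).

Definition gauss_peak : R := (Num.sqrt (pi *+ 2))^-1.

Lemma gauss_peak_gt0 : 0 < gauss_peak.
Proof. by rewrite invr_gt0 sqrtr_gt0 pmulrn_lgt0// pi_gt0. Qed.

Lemma gauss_peak_le1 : gauss_peak <= 1.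
Proof.
have pi1 : 1 <= (pi : R) *+ 2 by have := pi_ge2 R; rewrite mulr2n; lra.
have pi0 : 0 < (pi : R) *+ 2 by exact: lt_le_trans ltr01 pi1.
rewrite invf_le1 ?sqrtr_gt0// -[leLHS]sqrtr1.
by apply: ler_wsqrtr.
Qed.

Lemma normal_pdf_gauss m s y : 0 < s ->
  normal_pdf m s y = gauss_peak / s * gauss ((y - m) / s).
Proof.
move=> s0; rewrite normal_pdfE ?gt_eqF// /normal_peak /normal_fun /gauss.
congr (_ * expR _); last by field; rewrite gt_eqF.
rewrite -mulrnAr sqrtrM ?sqr_ge0// sqrtr_sqr gtr0_norm// invfM mulrC.
by [].
Qed.

Lemma gauss_gt0 t : 0 < gauss t. Proof. exact: expR_gt0. Qed.

Lemma normal_pdfC m s y : 0 < s -> normal_pdf m s y = normal_pdf y s m.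
Proof.
move=> s0; rewrite !normal_pdf_gauss// /gauss.
by rewrite (_ : (y - m) / s = - ((m - y) / s)) ?sqrrN// -mulNr opprB.
Qed.

(** The derivative [- t * gauss t] is bounded by [1], because
    [expR (t ^+ 2 / 2) >= 1 + t ^+ 2 / 2 >= `|t|]. *)
Lemma gauss_lipschitz u v : `|gauss u - gauss v| <= `|u - v|.
Proof.
wlog uv : u v / v <= u.
  move=> H; case: (leP v u) => [|/ltW] /H //.
  by rewrite distrC (distrC v).
have dg t : is_derive t 1 gauss (- t * gauss t).
  rewrite /gauss; apply: is_derive_eq.
  by rewrite /GRing.scale/=; field.
have [|c _ ->] := @MVT_segment R gauss (fun t => - t * gauss t) v u uv.
  apply: derivable_within_continuous => t _.
  by have /@ex_derive := dg t.
rewrite normrM ler_piMl// normrM normrN (gtr0_norm (gauss_gt0 _)).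
rewrite /gauss mulNr expRN -ler_pdivlMr ?invr_gt0 ?expR_gt0// invrK mul1r.
apply: le_trans (expR_ge1Dx _); rewrite -(real_normK (num_real c)).
by have := sqr_ge0 (`|c| - 1); rewrite !expr2; nra.
Qed.

Lemma gauss_peak_div_le s : 0 < s -> gauss_peak / s <= s^-1.
Proof. by move=> s0; rewrite ler_piMl ?gauss_peak_le1// invr_ge0 ltW. Qed.

Lemma normal_pdf_lipschitz s y u v : 0 < s ->
  `|normal_pdf u s y - normal_pdf v s y| <= `|u - v| / s ^+ 2.
Proof.
move=> s0; rewrite !normal_pdf_gauss// -mulrBr normrM.
have p0 : 0 <= gauss_peak / s by rewrite divr_ge0 ?ltW ?gauss_peak_gt0.
rewrite (ger0_norm p0).
apply: (@le_trans _ _ (s^-1 * (`|u - v| / s))); last first.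
  by rewrite le_eqVlt; apply/orP; left; apply/eqP; field; rewrite gt_eqF.
apply: ler_pM => //; first exact: gauss_peak_div_le.
apply: (le_trans (gauss_lipschitz _ _)).
rewrite -mulrBl normrM (gtr0_norm (x := s^-1)) ?invr_gt0//.
by rewrite opprB addrC subrKA distrC.
Qed.

(** The standard normal density at [1]. *)
Definition gauss_core : R := gauss_peak * gauss 1.

Lemma gauss_core_gt0 : 0 < gauss_core.
Proof. by rewrite mulr_gt0 ?gauss_peak_gt0 ?gauss_gt0. Qed.

Lemma normal_pdf_core m s y : 0 < s -> `|y - m| <= s ->
  gauss_core / s <= normal_pdf m s y.
Proof.
move=> s0 ym; rewrite normal_pdf_gauss// /gauss_core mulrAC ler_pM2l.
  rewrite ler_expR expr1n ler_pM2r ?invr_gt0// lerN2.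
  rewrite -(real_normK (num_real (_ / s))) exprn_ile1// normrM.
  by rewrite (gtr0_norm (x := s^-1)) ?invr_gt0// ler_pdivrMr// mul1r.
by rewrite divr_gt0// gauss_peak_gt0.
Qed.

(** The tail of a normal density is dominated by a small multiple of the
    density with twice the deviation, so that its integral can be bounded from
    the total mass alone. *)
Lemma normal_pdf_tail m s y d : 0 < s -> 0 < d -> d <= `|y - m| ->
  normal_pdf m s y <= 6 * s ^+ 2 / d ^+ 2 * normal_pdf m (2 * s) y.
Proof.
move=> s0 d0 dy; have s20 : 0 < 2 * s by rewrite mulr_gt0.
rewrite !normal_pdf_gauss//; set t := (y - m) / s.
have -> : (y - m) / (2 * s) = t / 2 by rewrite /t; field; rewrite gt_eqF.
have gE : gauss t = gauss (t / 2) * expR (- (3 / 8 * t ^+ 2)).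
  by rewrite /gauss -expRD; congr expR; field.
have dt : d / s <= `|t|.
  by rewrite /t normrM (gtr0_norm (x := s^-1)) ?invr_gt0// ler_pM2r ?invr_gt0.
have dt2 : d ^+ 2 / s ^+ 2 <= t ^+ 2.
  rewrite -(real_normK (num_real t)) -expr_div_n lerXn2r// nnegrE.
  by rewrite divr_ge0 ?ltW.
have ds0 : 0 < d ^+ 2 / s ^+ 2 by rewrite divr_gt0 ?exprn_gt0.
have et : expR (- (3 / 8 * t ^+ 2)) <= 3 * s ^+ 2 / d ^+ 2.
  rewrite expRN -[leRHS]invrK lef_pV2 ?posrE ?expR_gt0 ?invr_gt0 //; last first.
    by rewrite divr_gt0 ?mulr_gt0 ?exprn_gt0.
  have -> : (3 * s ^+ 2 / d ^+ 2)^-1 = d ^+ 2 / s ^+ 2 / 3.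
    by field; rewrite !gt_eqF.
  by apply: le_trans (expR_ge1Dx _); lra.
rewrite gE mulrA.
have -> : 6 * s ^+ 2 / d ^+ 2 * (gauss_peak / (2 * s) * gauss (t / 2)) =
    gauss_peak / s * gauss (t / 2) * (3 * s ^+ 2 / d ^+ 2).
  by field; rewrite !gt_eqF.
rewrite ler_pM2l// mulr_gt0 ?gauss_gt0// divr_gt0//.
exact: gauss_peak_gt0.
Qed.

End normal_bounds.

(** * Gaussian smoothing of a bounded density *)

Section smoothing.
Variables (R : realType) (g : R -> R) (M : R).
Local Notation mu := (@lebesgue_measure R).
Hypothesis mg : measurable_fun [set: R] g.
Hypothesis g_ge0 : forall u, 0 <= g u.
Hypothesis g_leM : forall u, g u <= M.
Hypothesis int_g : (\int[mu]_u (g u)%:E = 1)%E.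
Implicit Types (s y u : R).

(** The convolution of [g] with the centred normal density of deviation [s]: that
    density is even, so the point [y] may be put in the place of the mean. *)
Definition smooth s y : R := \int[mu]_u (g u * normal_pdf y s u).

Lemma integrable_density : mu.-integrable [set: R] (EFin \o g).
Proof.
apply/integrableP; split; first exact/measurable_EFinP.
under eq_integral => u _ do rewrite gee0_abs ?lee_fin//.
by rewrite int_g ltry.
Qed.

Lemma integrable_densityM s y : 0 < s ->
  mu.-integrable [set: R] (fun u => (g u * normal_pdf y s u)%:E).
Proof.
move=> s0; apply: (@integrableMl _ _ _ mu _ measurableT (EFin \o g)
  (normal_pdf y s) integrable_density).
  exact: measurable_normal_pdf.
exists (normal_peak s); split; [exact: num_real|move=> x px u _ /=].
rewrite ger0_norm ?normal_pdf_ge0// (le_trans _ (ltW px))//.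
by rewrite normal_pdf_ub// gt_eqF.
Qed.

Lemma Rint_normal_pdf s y : \int[mu]_u normal_pdf y s u = 1.
Proof. by rewrite /Rintegral integral_normal_pdf. Qed.

Lemma smooth_le s y : 0 < s -> smooth s y <= M.
Proof.
move=> s0; rewrite -[leRHS]mulr1 -(Rint_normal_pdf s y) -RintegralZl//.
  apply: le_Rintegral => //.
  - exact: integrable_densityM.
  - by apply: (integrableZl _ _ (integrable_normal_pdf y s)).
  - by move=> u _; rewrite ler_wpM2r// normal_pdf_ge0.
exact: integrable_normal_pdf.
Qed.

(** Only the part of the kernel within one standard deviation is kept, where it
    is at least [gauss_core R / s]. *)
Lemma smooth_ge s y c t t' : 0 < s -> 0 <= c -> t <= t' ->
    (forall u, t < u < t' -> c <= g u /\ `|u - y| <= s) ->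
  c * (t' - t) * gauss_core R / s <= smooth s y.
Proof.
move=> s0 c0 tt' cg.
pose I := `]t, t'[%classic.
have mI : measurable I by exact: measurable_itv.
have iI : mu.-integrable I (fun u => (g u * normal_pdf y s u)%:E).
  exact: integrableS (integrable_densityM y s0).
apply: (@le_trans _ _ (\int[mu]_(u in I) (g u * normal_pdf y s u))).
  apply: (@le_trans _ _ (\int[mu]_(u in I) (c * (gauss_core R / s)))).
    rewrite Rintegral_cst//= lebesgue_measure_itv/=.
    have -> : fine (if (t%:E < t'%:E)%E then (t'%:E - t%:E)%E else 0%E) = t' - t.
      case: ifPn => //; rewrite lte_fin -leNgt => t't.
      by have -> : t' = t; [apply/eqP; rewrite eq_le t't|rewrite subrr].
    by rewrite le_eqVlt; apply/orP; left; apply/eqP; ring.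
  apply: le_Rintegral => //.
    apply: measurable_bounded_integrable => //.
      rewrite /= lebesgue_measure_itv/=; case: ifP => _; last exact: ltry.
      by rewrite -EFinB ltry.
    exists `|c * (gauss_core R / s)|; split; first exact: num_real.
    by move=> x /ltW cx u _.
  move=> u; rewrite /I/= in_itv/= => /cg[cu uy].
  by apply: ler_pM => //; [rewrite divr_ge0// ltW// gauss_core_gt0|
    exact: normal_pdf_core].
rewrite /smooth /Rintegral fine_le//.
- exact: integrable_fin_num iI.
- exact: integrable_fin_num (integrable_densityM y s0).
- apply: ge0_subset_integral => //.
    exact: measurable_int (integrable_densityM y s0).
  by move=> u _; rewrite lee_fin mulr_ge0// normal_pdf_ge0.
Qed.

(** Near [y] the integrand is controlled by continuity; away from [y] the kernel
    is at most [6 * s ^+ 2 / h ^+ 2] times a probability density. *)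
Lemma smooth_cvg y e : {for y, continuous g} -> 0 < e ->
  exists2 d, 0 < d & forall s, 0 < s -> s < d -> `|smooth s y - g y| <= e.
Proof.
move=> cg e0.
have M0 : 0 <= M by exact: le_trans (g_ge0 0) (g_leM 0).
have e2 : 0 < e / 2 by lra.
have /nbhs_ballP[h /= h0 hP] : \forall u \near y, `|g y - g u| < e / 2.
  by move/cvgrPdist_lt : cg => /(_ _ e2).
pose K := 6 * M / h ^+ 2.
have K0 : 0 <= K.
  by apply: divr_ge0; [apply: mulr_ge0|exact: sqr_ge0].
have gM u : `|g u - g y| <= M.
  have := g_ge0 u; have := g_ge0 y; have := g_leM u; have := g_leM y.
  by rewrite ler_norml => ? ? ? ?; apply/andP; split; lra.
exists (Num.min 1 (e / 2 / (K + 1))).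
  by rewrite lt_min ltr01/= divr_gt0//; lra.
move=> s s0; rewrite lt_min => /andP[s1].
rewrite ltr_pdivlMr; last lra; move=> sK.
have s20 : 0 < 2 * s by lra.
have Ks : K * s ^+ 2 <= e / 2.
  have : s * (K * s) <= 1 * (K * s).
    by apply: ler_wpM2r; [apply: mulr_ge0 => //|]; exact: ltW.
  rewrite expr2; nra.
have i1 := integrable_densityM y s0.
have i2 := integrable_normal_pdf y s.
have i3 := integrable_normal_pdf y (2 * s).
have i2g : mu.-integrable setT (fun u => (g y * normal_pdf y s u)%:E).
  exact: (integrableZl _ _ i2).
have i2e : mu.-integrable setT (fun u => (e / 2 * normal_pdf y s u)%:E).
  exact: (integrableZl _ _ i2).
have i3K : mu.-integrable setT
    (fun u => (K * s ^+ 2 * normal_pdf y (2 * s) u)%:E).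
  exact: (integrableZl _ _ i3).
have -> : smooth s y - g y =
    \int[mu]_u (g u * normal_pdf y s u - g y * normal_pdf y s u).
  rewrite RintegralB// RintegralZl//.
  by rewrite Rint_normal_pdf mulr1.
apply: le_trans (le_normr_Rintegral _ _) _ => //.
  exact: (integrableB _ i1 i2g).
apply: (@le_trans _ _ (e / 2 + K * s ^+ 2)); last by lra.
have -> : e / 2 = \int[mu]_u (e / 2 * normal_pdf y s u).
  by rewrite RintegralZl// Rint_normal_pdf mulr1.
have -> : K * s ^+ 2 = \int[mu]_u (K * s ^+ 2 * normal_pdf y (2 * s) u).
  by rewrite RintegralZl// Rint_normal_pdf mulr1.
rewrite -RintegralD//.
apply: le_Rintegral => //.
- exact: integrable_norm (integrableB _ i1 i2g).
- exact: (integrableD _ i2e i3K).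
move=> u _; rewrite -mulrBl normrM (ger0_norm (normal_pdf_ge0 _ _ _)).
have p1 := normal_pdf_ge0 y s u; have p2 := normal_pdf_ge0 y (2 * s) u.
have [uy|uy] := ltP `|y - u| h.
  apply: (@le_trans _ _ (e / 2 * normal_pdf y s u)).
    by rewrite ler_wpM2r// distrC ltW// hP.
  by rewrite lerDl mulr_ge0// mulr_ge0// sqr_ge0.
apply: (@le_trans _ _ (K * s ^+ 2 * normal_pdf y (2 * s) u)); last first.
  by rewrite lerDr mulr_ge0// ltW.
apply: (@le_trans _ _ (M * normal_pdf y s u)); first by rewrite ler_wpM2r.
rewrite distrC in uy.
apply: (le_trans (ler_wpM2l M0 (normal_pdf_tail s0 h0 uy))).
rewrite mulrA le_eqVlt; apply/orP; left; apply/eqP; congr (_ * _).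
by rewrite /K; field; rewrite gt_eqF.
Qed.


End smoothing.

(** * Discretizing a smoothed density at its quantiles *)

Section quantile_discretization.
Variables (R : realType) (g : R -> R) (M a b : R).
Local Notation mu := (@lebesgue_measure R).
Hypothesis mg : measurable_fun [set: R] g.
Hypothesis g_ge0 : forall u, 0 <= g u.
Hypothesis g_leM : forall u, g u <= M.
Hypothesis int_g : (\int[mu]_u (g u)%:E = 1)%E.
Hypothesis g_out : forall u, u \notin `[a, b] -> g u = 0.
Hypothesis g_gt0 : forall u, a < u < b -> 0 < g u.
Implicit Types (s y u p : R).

Definition density_cdf y : R := \int[mu]_(u in `]-oo, y]) g u.

Let integrable_g := integrable_density mg g_ge0 int_g.

Let integrable_gS (D : set R) : measurable D -> mu.-integrable D (EFin \o g).
Proof. by move=> mD; apply: integrableS integrable_g. Qed.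

Lemma cdfB s t : s <= t -> density_cdf t - density_cdf s = \int[mu]_(u in `]s, t]) g u.
Proof.
move=> st; rewrite /density_cdf; apply: Rintegral_itvB; rewrite ?bnd_simp//.
exact: integrable_gS.
Qed.

Lemma le_cdf s t : s <= t -> density_cdf s <= density_cdf t.
Proof.
by move=> st; rewrite -subr_ge0 cdfB//; apply: Rintegral_ge0.
Qed.

Lemma cdf_lipschitz s t : s <= t -> density_cdf t - density_cdf s <= M * (t - s).
Proof.
move=> st; rewrite cdfB//.
have mI : mu `]s, t] = (t - s)%:E.
  rewrite lebesgue_measure_itv/=; case: ifPn => //.
  by rewrite lte_fin -leNgt => ts; have -> : t = s by [apply/eqP; rewrite eq_le ts]; rewrite subrr.
apply: (@le_trans _ _ (\int[mu]_(u in `]s, t]) M)).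
  apply: le_Rintegral => //; first exact: integrable_gS.
  apply: measurable_bounded_integrable => //; first by rewrite /= mI ltry.
  by exists `|M|; split; [exact: num_real|move=> x /ltW Mx u _].
by rewrite Rintegral_cst//= mI.
Qed.

(** Positivity of [g] inside the support makes the distribution function
    injective there, so that quantiles are characterized by their level. *)
Lemma lt_cdf s t : a <= s -> s < t -> t <= b -> density_cdf s < density_cdf t.
Proof.
move=> ast st tb; rewrite lt_neqAle le_cdf ?ltW// andbT; apply/eqP => cst.
have I0 : (\int[mu]_(u in `]s, t]) `|(g u)%:E| = 0)%E.
  under eq_integral do rewrite gee0_abs ?lee_fin//.
  rewrite -[LHS]fineK; last exact: integrable_fin_num (integrable_gS _).
  by have := cdfB (ltW st); rewrite /Rintegral cst subrr => <-.
have /(ae_eq_integral_abs mu (measurable_itv _)) : measurable_fun `]s, t] (EFin \o g).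
  by apply/measurable_EFinP; exact: measurable_funTS.
move=> [+ _] => /(_ I0) [N [mN N0 subN]].
have : (mu `]s, t[ <= mu N)%E.
  apply: le_measure; rewrite ?inE//.
  move=> u /=; rewrite in_itv/= => /andP[su ut]; apply: subN => /=.
  rewrite in_itv/= su (ltW ut) => /(_ isT) [] /eqP.
  by apply/negP; rewrite gt_eqF// g_gt0// (le_lt_trans ast su) (lt_le_trans ut).
by rewrite N0 lebesgue_measure_itv/= lte_fin st -EFinB lee_fin leNgt subr_gt0 st.
Qed.

Hypothesis ab : a <= b.

Lemma cdf_left : density_cdf a = 0.
Proof.
rewrite /density_cdf -Rintegral_itv_bndo_bndc; last exact: integrable_gS.
rewrite (@eq_Rintegral _ _ _ _ _ (cst 0)); first by rewrite Rintegral_cst// mul0r.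
move=> u; rewrite inE/= in_itv/= => ua; apply: g_out.
by rewrite in_itv/= negb_and -ltNge ua.
Qed.

Lemma cdf_right : density_cdf b = 1.
Proof.
rewrite /density_cdf Rintegral_mkcond (_ : _ \_ _ = g); first by rewrite /Rintegral int_g.
apply/funext => u; rewrite patchE; case: ifPn => //.
rewrite notin_setE/= in_itv/= => /negP; rewrite -ltNge => bu.
by rewrite g_out// in_itv/= negb_and -(ltNge b) bu orbT.
Qed.

Lemma cdf_onto p : 0 <= p <= 1 -> exists2 t, t \in `[a, b] & density_cdf t = p.
Proof.
move=> /andP[p0 p1].
have M0 : 0 <= M by exact: le_trans (g_ge0 0) (g_leM 0).
apply: IVT => //; last first.
  by rewrite cdf_left cdf_right min_l ?max_r ?ler01 ?p0.
have lip y z : `|density_cdf y - density_cdf z| <= (M + 1) * `|y - z|.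
  wlog yz : y z / y <= z.
    move=> H; case: (leP y z) => [|/ltW] /H //.
    by rewrite distrC (distrC z).
  rewrite (distrC (density_cdf y)) (distrC y) (@ger0_norm _ (_ - _)).
    by rewrite ger0_norm ?subr_ge0//; have := cdf_lipschitz yz; nra.
  by rewrite subr_ge0 le_cdf.
apply: continuous_subspaceT => y; apply/cvgrPdist_le => e e0.
near=> z; apply: le_trans (lip y z) _.
rewrite mulrC -ler_pdivlMr; last lra.
near: z; apply: cvgr_dist_le => //.
by rewrite divr_gt0//; lra.
Unshelve. all: by end_near. Qed.

Lemma inf_cdf t : t \in `[a, b] ->
  inf [set y | y \in `[a, b] /\ density_cdf t <= density_cdf y] = t.
Proof.
move=> tab; have tS : [set y | y \in `[a, b] /\ density_cdf t <= density_cdf y] t by [].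
apply/eqP; rewrite eq_le; apply/andP; split.
  apply: ge_inf => //; exists a => y /= [+ _].
  by rewrite in_itv => /andP[].
apply: lb_le_inf; first by exists t.
move=> y /= [+ ty]; move: tab; rewrite !in_itv/= => /andP[_ tb] /andP[ay _].
by rewrite leNgt; apply/negP => /(lt_cdf ay)/(_ tb); rewrite ltNge ty.
Qed.

Section kernel.
Variables (h : R -> R) (K : R).
Hypothesis mh : measurable_fun [set: R] h.
Hypothesis h_bounded : forall u, `|h u| <= K.

Let integrable_gh (D : set R) : measurable D ->
  mu.-integrable D (fun u => (g u * h u)%:E).
Proof.
move=> mD; apply: (@integrableMl _ _ _ mu _ mD (EFin \o g) h).
- exact: integrable_gS.
- exact: measurable_funTS.
- by exists K; split; [exact: num_real|move=> x /ltW Kx u _; apply: le_trans Kx].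
Qed.

Definition weighted_cdf y : R := \int[mu]_(u in `]-oo, y]) (g u * h u).

(** Between [s] and [t], the measure of density [g] integrates the kernel to its
    mass times [c], up to its mass times the oscillation of the kernel about
    [c]. *)
Lemma weighted_cdf_step s t c e : s <= t ->
    (forall u, s < u <= t -> `|h u - c| <= e) ->
  `|c * (density_cdf t - density_cdf s) - (weighted_cdf t - weighted_cdf s)| <=
  e * (density_cdf t - density_cdf s).
Proof.
move=> st hc.
have -> : weighted_cdf t - weighted_cdf s = \int[mu]_(u in `]s, t]) (g u * h u).
  rewrite /weighted_cdf; apply: Rintegral_itvB; rewrite ?bnd_simp//.
  exact: integrable_gh.
rewrite !cdfB// -!RintegralZl//; try exact: integrable_gS.
have ic k : mu.-integrable `]s, t] (fun u => (k * g u)%:E).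
  by apply: (integrableZl _ _ (integrable_gS _)).
have igh := integrable_gh (measurable_itv `]s, t]).
rewrite -RintegralB//; last exact: ic.
apply: le_trans (le_normr_Rintegral _ _) _ => //.
  exact: (integrableB _ (ic c) igh).
apply: le_Rintegral => //.
- exact: integrable_norm (integrableB _ (ic c) igh).
- exact: ic.
move=> u /=; rewrite in_itv/= => /hc hu.
rewrite [c * _]mulrC -mulrBr normrM ger0_norm// mulrC ler_wpM2r//.
by rewrite distrC.
Qed.

Lemma weighted_cdf_total :
  weighted_cdf b - weighted_cdf a = \int[mu]_u (g u * h u).
Proof.
rewrite /weighted_cdf -[X in _ - X]Rintegral_itv_bndo_bndc; last exact: integrable_gh.
rewrite [X in _ - X](@eq_Rintegral _ _ _ _ _ (cst 0)); last first.
  move=> u; rewrite inE/= in_itv/= => ua; rewrite g_out ?mul0r//.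
  by rewrite in_itv/= negb_and -ltNge ua.
rewrite Rintegral_cst// mul0r subr0 Rintegral_mkcond; congr Rintegral.
apply/funext => u; rewrite patchE; case: ifPn => //.
rewrite notin_setE/= in_itv/= => /negP; rewrite -ltNge => bu.
by rewrite g_out ?mul0r// in_itv/= negb_and -(ltNge b) bu orbT.
Qed.

End kernel.

(** The [j]-th cell between consecutive quantiles carries mass [1/m], so
    replacing the kernel on it by its value at a nearby point costs at most
    [1/m] times the Lipschitz constant times the length of the cell; the
    lengths of the cells add up to [b - a]. *)
Lemma mixture_smooth s y m (q : nat -> R) (t : 'I_m -> R) : 0 < s -> (0 < m)%N ->
    (forall j, (j <= m)%N -> q j \in `[a, b] /\ density_cdf (q j) = j%:R / m%:R) ->
    (forall j : 'I_m, `|t j - q j.+1| <= m%:R^-1) ->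
  `|\sum_(j < m) m%:R^-1 * normal_pdf (t j) s y - smooth g s y| <=
  (b - a + 1) / (m%:R * s ^+ 2).
Proof.
move=> s0 m0 qP tq.
have m0' : 0 < m%:R :> R by rewrite ltr0n.
have qle j : (j < m)%N -> q j <= q j.+1.
  move=> jm; have [_ cj] := qP _ (ltnW jm).
  have [+ cj1] := qP _ jm; have [+ _] := qP _ (ltnW jm).
  rewrite !in_itv/= => /andP[_ jb] /andP[aj _].
  rewrite leNgt; apply/negP => /(lt_cdf aj)/(_ jb).
  by rewrite cj cj1 ltNge ler_pM2r ?invr_gt0// ler_nat leqnSn.
have q0 : q 0%N = a.
  have [+ c0] := qP _ (leq0n m); rewrite in_itv/= le_eqVlt => /andP[/predU1P[//|aq0 qb]].
  by have := lt_cdf (lexx a) aq0 qb; rewrite c0 cdf_left mul0r ltxx.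
have qm : q m = b.
  have [+ cm] := qP _ (leqnn m); rewrite in_itv/= [_ <= b]le_eqVlt.
  move=> /andP[aq /predU1P[//|qb]].
  by have := lt_cdf aq qb (lexx b); rewrite cm cdf_right divff ?gt_eqF// ltxx.
pose h := normal_pdf y s.
have mh : measurable_fun setT h by exact: measurable_normal_pdf.
have hb u : `|h u| <= normal_peak s.
  by rewrite ger0_norm ?normal_pdf_ge0// normal_pdf_ub// gt_eqF.
have -> : smooth g s y = \sum_(j < m) (weighted_cdf h (q j.+1) - weighted_cdf h (q j)).
  rewrite -(@big_mkord _ 0 _ m xpredT (fun j => weighted_cdf h (q j.+1) - weighted_cdf h (q j))).
  by rewrite telescope_sumr// q0 qm (weighted_cdf_total mh hb).
rewrite -sumrB; apply: le_trans (ler_norm_sum _ _ _) _.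
pose e j := (q j.+1 - q j + m%:R^-1) / s ^+ 2.
apply: (@le_trans _ _ (\sum_(j < m) e j * m%:R^-1)).
  apply: ler_sum => j _.
  have cdj : density_cdf (q j.+1) - density_cdf (q j) = m%:R^-1.
    have [_ ->] := qP _ (ltn_ord j); have [_ ->] := qP _ (ltnW (ltn_ord j)).
    by rewrite -mulrBl -natrB// subSnn mul1r.
  rewrite -cdj mulrC; apply: (weighted_cdf_step mh hb (qle _ (ltn_ord j))).
  move=> u /andP[qu uq]; rewrite /h (normal_pdfC y)//.
  apply: (le_trans (normal_pdf_lipschitz _ _ _ s0)).
  rewrite /e ler_pM2r ?invr_gt0 ?exprn_gt0//.
  have := tq j; rewrite !ler_norml => /andP[? ?].
  have : 0 <= m%:R^-1 :> R by rewrite invr_ge0 ltW.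
  by move=> ?; apply/andP; split; lra.
rewrite -mulr_suml -mulr_suml big_split/= sumr_const card_ord.
rewrite -(@big_mkord _ 0 _ m xpredT (fun j => q j.+1 - q j)) telescope_sumr//.
rewrite q0 qm -[m%:R^-1 *+ m]mulr_natl divff ?gt_eqF//.
by rewrite le_eqVlt; apply/orP; left; apply/eqP; field; rewrite !gt_eqF.
Qed.

End quantile_discretization.

(** * Lower bounds for the smoothed density *)

Section smoothing_lower_bound.
Variables (R : realType) (g : R -> R) (M a b a1 b1 fmin r : R) (n : nat).
Hypothesis mg : measurable_fun [set: R] g.
Hypothesis g_ge0 : forall u, 0 <= g u.
Hypothesis g_leM : forall u, g u <= M.
Hypothesis int_g : (\int[lebesgue_measure]_u (g u)%:E = 1)%E.
Hypothesis fmin_gt0 : 0 < fmin.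
Hypothesis fmin_leM : fmin <= M.
Hypothesis a1_le_b1 : a1 <= b1.
Hypothesis g_mid : forall u, a1 <= u <= b1 -> fmin <= g u.
Hypothesis g_left : forall u, a < u < a1 -> fmin * (u - a) ^+ n <= g u.
Hypothesis g_right : forall u, b1 < u < b -> fmin * (b - u) ^+ n <= g u.
Hypothesis g_incr : {in `]a, (a1 + r / 2)[ &, {homo g : u v / u <= v}}.
Hypothesis g_decr : {in `](b1 - r / 2), b[ &, {homo g : u v /~ u <= v}}.
Implicit Types (s y u : R).

Let incr u v : a < u -> u <= v -> v < a1 + r / 2 -> g u <= g v.
Proof.
move=> au uv va; apply: g_incr => //; rewrite in_itv/=; apply/andP; split; lra.
Qed.

Let decr u v : b1 - r / 2 < u -> u <= v -> v < b -> g v <= g u.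
Proof.
move=> bu uv vb; apply: g_decr => //; rewrite in_itv/=; apply/andP; split; lra.
Qed.

(** Near every point of the support, on at least one side, the density does
    not drop much below its value at the point, and it exceeds the polynomial
    lower bound once half a step away.  In the tails this is monotonicity,
    moving inwards; in the middle it is the uniform lower bound. *)
Lemma one_sided_lower_bound s y : 0 < s -> s <= 1 -> s <= r / 4 -> a < y < b ->
  exists t, [/\ t = y \/ t = y - s,
    forall u, t < u < t + s -> fmin / M * g y <= g u &
    forall u, t < u < t + s -> s / 2 <= `|u - y| -> fmin * (s / 2) ^+ n <= g u].
Proof.
move=> s0 s1 sr /andP[ay yb].
have M0 : 0 < M by exact: lt_le_trans fmin_leM.
have fM : fmin / M * g y <= g y.
  by rewrite ler_piMl// ler_pdivrMr// mul1r.
have fMy : fmin / M * g y <= fmin.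
  by rewrite mulrAC ler_pdivrMr// ler_pM2l.
have sn1 : fmin * (s / 2) ^+ n <= fmin.
  by rewrite ler_piMr ?(ltW fmin_gt0)// exprn_ile1//; lra.
have mid1 u : fmin <= g u -> fmin / M * g y <= g u by exact: le_trans.
have mid2 u : fmin <= g u ->
    s / 2 <= `|u - y| -> fmin * (s / 2) ^+ n <= g u.
  by move=> fu _; exact: le_trans fu.
have pow t : s / 2 <= t -> fmin * (s / 2) ^+ n <= fmin * t ^+ n.
  by move=> st; rewrite ler_pM2l// lerXn2r// nnegrE; lra.
have [ya1|a1y] := ltP y a1.
  exists y; split; [by left| |] => u /andP[yu us].
    by apply: (le_trans fM); apply: incr => //; lra.
  rewrite ger0_norm ?subr_ge0 ?(ltW yu)// => suy.
  have [ua1|a1u] := ltP u a1.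
    by apply: (le_trans _ (g_left _)); [apply: pow|]; lra.
  apply: (le_trans sn1); apply: (@le_trans _ _ (g a1)).
    by apply: g_mid; rewrite lexx.
  by apply: incr => //; lra.
have [yb1|b1y] := ltP b1 y.
  exists (y - s); split; [by right| |] => u; rewrite subrK => /andP[us uy].
    by apply: (le_trans fM); apply: decr => //; lra.
  rewrite ler0_norm ?subr_le0 ?(ltW uy)// opprB => suy.
  have [ub1|b1u] := ltP b1 u.
    by apply: (le_trans _ (g_right _)); [apply: pow|]; lra.
  apply: (le_trans sn1); apply: (@le_trans _ _ (g b1)).
    by apply: g_mid; rewrite lexx andbT.
  by apply: decr => //; lra.
have fy : fmin <= g y by apply: g_mid; rewrite a1y.
have [ysb|bys] := leP (y + s) b1.
  exists y; split; [by left| |] => u /andP[yu us]; first [apply: mid1|apply: mid2]; apply: g_mid;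
    by apply/andP; split; lra.
have [ays|ysa] := leP a1 (y - s).
  exists (y - s); split; [by right| |] => u; rewrite subrK => /andP[us uy];
    first [apply: mid1|apply: mid2]; apply: g_mid; by apply/andP; split; lra.
exists y; split; [by left| |] => u /andP[yu us]; 
  first [apply: mid1|apply: mid2]; apply: (le_trans fy); apply: incr => //; lra.
Qed.

Definition smoothing_const : R :=
  Num.min (fmin / M) (fmin / 2 ^+ n.+1) * gauss_core R.

Lemma smoothing_const_gt0 : 0 < smoothing_const.
Proof.
have M0 : 0 < M by exact: lt_le_trans fmin_leM.
by rewrite mulr_gt0 ?gauss_core_gt0// lt_min !divr_gt0// exprn_gt0.
Qed.

(** Two integrations over the one-sided neighbourhood of length [s]: the whole of
    it compares the convolution with the density itself, and its outer half gives
    a bound that does not degenerate at the end points of the support. *)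
Lemma smooth_lower_bound s y : 0 < s -> s <= 1 -> s <= r / 4 -> a < y < b ->
  smoothing_const * g y <= smooth g s y /\ smoothing_const * s ^+ n <= smooth g s y.
Proof.
move=> s0 s1 sr yab; have [t [ty gt1 gt2]] := one_sided_lower_bound s0 s1 sr yab.
have M0 : 0 < M by exact: lt_le_trans fmin_leM.
have core0 := gauss_core_gt0 R.
have uy u : t < u < t + s -> `|u - y| <= s.
  by rewrite ler_norml; case: ty => -> /andP[? ?]; apply/andP; split; lra.
have sn0 : 0 <= fmin * (s / 2) ^+ n.
  by rewrite mulr_ge0 ?(ltW fmin_gt0)// exprn_ge0//; lra.
split.
  have c0 : 0 <= fmin / M * g y.
    by rewrite mulr_ge0// divr_ge0// ltW.
  apply: (@le_trans _ _ (fmin / M * g y * (t + s - t) * gauss_core R / s)).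
    rewrite [leRHS](_ : _ = fmin / M * gauss_core R * g y); last first.
      by field; rewrite !gt_eqF.
    rewrite ler_wpM2r// /smoothing_const ler_wpM2r ?(ltW core0)//.
    by rewrite ge_min lexx.
  apply: smooth_ge => //; first by rewrite lerDl ltW.
  by move=> u tu; split; [exact: gt1|exact: uy].
have [t' [t't gt3]] : exists t', [/\ t <= t', t' + s / 2 <= t + s &
    forall u, t' < u < t' + s / 2 -> s / 2 <= `|u - y|].
  case: ty => ->.
    exists (y + s / 2); split; [lra|lra|] => u /andP[? ?].
    by rewrite ger0_norm; lra.
  exists (y - s); split; [lra|lra|] => u /andP[? ?].
  by rewrite ler0_norm; lra.
move=> gt4.
apply: (@le_trans _ _ (fmin * (s / 2) ^+ n * (t' + s / 2 - t') * gauss_core R / s)).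
  rewrite [leRHS](_ : _ = fmin / 2 ^+ n.+1 * gauss_core R * s ^+ n); last first.
    rewrite exprMn exprVn exprS; field; rewrite gt_eqF//=.
    by rewrite gt_eqF// exprn_gt0.
  rewrite ler_wpM2r ?exprn_ge0 ?(ltW s0)// /smoothing_const ler_wpM2r ?(ltW core0)//.
  by rewrite ge_min lexx orbT.
apply: smooth_ge => //; first by rewrite lerDl; lra.
move=> u tu; have tu' : t < u < t + s by case/andP: tu => ? ?; apply/andP; split; lra.
by split; [apply: gt2 => //; exact: gt4|exact: uy].
Qed.


End smoothing_lower_bound.

(** * Disintegration of a joint law along a conditional density *)

Section integral_density.
Local Open Scope ereal_scope.
Context d (T : measurableType d) (R : realType).
Variables (nu : {finite_measure set T -> \bar R})
          (mu : {sigma_finite_measure set T -> \bar R}) (w : T -> \bar R).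
Hypothesis mw : measurable_fun [set: T] w.
Hypothesis w_ge0 : forall x, 0 <= w x.
Hypothesis nuE : forall A, measurable A -> nu A = \int[mu]_(x in A) w x.

(** The density [w] is almost everywhere the Radon-Nikodym derivative of [nu], for
    which the change of variables holds. *)
Lemma ge0_integral_density (h : T -> \bar R) : measurable_fun [set: T] h ->
  (forall x, 0 <= h x) -> \int[nu]_x h x = \int[mu]_x (h x * w x).
Proof.
move=> mh h0.
have numu : nu `<< mu.
  apply/null_content_dominatesP => A mA muA.
  rewrite nuE//; apply: null_set_integral => //; exact: measurable_funTS.
have iw : mu.-integrable setT w.
  apply/integrableP; split => //.
  under eq_integral => x _ do rewrite gee0_abs//.
  by rewrite -nuE// -ge0_fin_numE ?measure_ge0// fin_num_measure.
rewrite -(Radon_Nikodym_SigmaFinite.change_of_variables numu)//.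
apply: ge0_ae_eq_integral => //.
- apply: emeasurable_funM => //.
  exact: measurable_int (Radon_Nikodym_SigmaFinite.f_integrable numu).
- exact: emeasurable_funM.
- by move=> x _; rewrite mule_ge0// Radon_Nikodym_SigmaFinite.f_ge0.
- by move=> x _; rewrite mule_ge0.
apply: ae_eqe_mul2l.
apply: integral_ae_eq => //.
- exact: Radon_Nikodym_SigmaFinite.f_integrable.
- by move=> E _ mE; rewrite -nuE// -Radon_Nikodym_SigmaFinite.f_integral.
Qed.

End integral_density.

Section disintegration.
Local Open Scope ereal_scope.
Context d1 d2 (T1 : measurableType d1) (T2 : measurableType d2) (R : realType).
Variables (P : {finite_measure set (T1 * T2)%type -> \bar R})
  (la : {sigma_finite_measure set T1 -> \bar R})
  (mu : {finite_measure set T2 -> \bar R})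
  (X : set T2) (k : T2 -> T1 -> R).
Hypothesis mX : measurable X.
Hypothesis mk : measurable_fun (setT `*` X) (fun z : (T1 * T2)%type => k z.2 z.1).
Hypothesis k_ge0 : forall x y, X x -> (0 <= k x y)%R.
Hypothesis PE : forall B C, measurable B -> measurable C ->
  P (B `*` C) = \int[mu]_(x in X `&` C) \int[la]_(y in B) (k x y)%:E.

Definition joint_density : (T1 * T2)%type -> \bar R :=
  (fun z => (k z.2 z.1)%:E) \_ (setT `*` X).

Lemma measurable_joint_density : measurable_fun [set: (T1 * T2)%type] joint_density.
Proof.
apply/(measurable_restrictT _ _).1; first exact: measurableX.
exact/measurable_EFinP.
Qed.

Lemma joint_density_ge0 z : 0 <= joint_density z.
Proof.
rewrite /joint_density patchE; case: ifPn => //; rewrite inE => -[_ /= Xz].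
by rewrite lee_fin k_ge0.
Qed.

Lemma iterated_joint_density (h : (T1 * T2)%type -> \bar R) :
  measurable_fun [set: (T1 * T2)%type] h -> (forall z, 0 <= h z) ->
  \int[la \x mu]_z (h z * joint_density z) =
  \int[mu]_(x in X) \int[la]_y (h (y, x) * (k x y)%:E).
Proof.
move=> mh h0.
have mhw := emeasurable_funM mh measurable_joint_density.
have hw0 z : 0 <= h z * joint_density z by rewrite mule_ge0// joint_density_ge0.
rewrite fubini_tonelli1// fubini_tonelli// [RHS]integral_mkcond.
apply: eq_integral => x _; rewrite patchE; case: ifPn => [xX|nxX].
  apply: eq_integral => y _; rewrite /joint_density patchE ifT// inE.
  by split => //=; rewrite inE in xX.
apply: integral0_eq => y _; rewrite /joint_density patchE ifF ?mule0//.
by apply/negbTE; move: nxX; apply: contraNN; rewrite !inE => -[].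
Qed.

(** Both sides are measures that agree on rectangles, by Tonelli's theorem, and
    rectangles generate the product sigma-algebra. *)
Lemma joint_densityE A : measurable A ->
  P A = \int[la \x mu]_(z in A) joint_density z.
Proof.
move=> mA.
have mw := measurable_joint_density.
pose nu (B : set (T1 * T2)%type) := \int[la \x mu]_(z in B) joint_density z.
have nu0 : nu set0 = 0 by rewrite /nu integral_set0.
have nu_ge0 B : 0 <= nu B.
  by apply: integral_ge0 => z _; exact: joint_density_ge0.
have nus : semi_sigma_additive nu.
  exact: semi_sigma_additive_nng_induced mw joint_density_ge0.
pose nuM := isMeasure.Build _ _ _ nu nu0 nu_ge0 nus.
pose nu' : {measure set (T1 * T2)%type -> \bar R} := HB.pack nu nuM.
pose C : set (set (T1 * T2)%type) :=
  [set D | exists A, measurable A /\ exists B, measurable B /\ D = A `*` B].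
suff : P A = nu' A by [].
apply: (measure_unique C (fun=> setT)) => //.
- rewrite measurable_prod_measurableType //; congr (<<s _ >>).
  rewrite predeqE; split => [[B mB [D mD <-]]|[B [mB [D [mD ->]]]]].
    by exists B; split => //; exists D.
  by exists B => //; exists D.
- move=> /= _ _ [X1 [mX1 [X2 [mX2 ->]]]] [Y1 [mY1 [Y2 [mY2 ->]]]].
  rewrite -setXI; exists (X1 `&` Y1); split; first exact: measurableI.
  by exists (X2 `&` Y2); split => //; exact: measurableI.
- by move=> _; exists setT; split => //; exists setT; split => //; rewrite setXTT.
- by rewrite bigcup_const.
- move=> _ [B [mB [D [mD ->]]]]; apply: (etrans (PE mB mD)).
  rewrite [RHS]integral_mkcond.
  pose h (z : (T1 * T2)%type) : \bar R := (\1_(B `*` D) z)%:E.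
  transitivity (\int[la \x mu]_z (h z * joint_density z)); last first.
    apply: eq_integral => z _; rewrite patchE /h indicE.
    by case: ifPn => zBD /=; rewrite ?mul1e ?mul0e.
  rewrite iterated_joint_density; last 2 first.
  + by apply/measurable_EFinP; apply: measurable_indic; exact: measurableX.
  + by move=> z; rewrite lee_fin.
  rewrite integral_mkcondr; apply: eq_integral => x _; rewrite patchE /h.
  case: ifPn => [xD|nxD].
    rewrite integral_mkcond; apply: eq_integral => y _.
    rewrite patchE indicE in_setX xD andbT.
    by case: ifPn => zBD /=; rewrite ?mul1e ?mul0e.
  rewrite integral0_eq// => y _.
  by rewrite indicE in_setX (negbTE nxD) andbF mul0e.
- by move=> _; rewrite -ge0_fin_numE ?measure_ge0// fin_num_measure.
Qed.

Lemma ge0_integral_joint_density (h : T1 * T2 -> \bar R) :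
  measurable_fun [set: T1 * T2] h -> (forall z, 0 <= h z) ->
  \int[P]_z h z = \int[la \x mu]_z (h z * joint_density z).
Proof.
move=> mh h0.
(* mu is finite, so the cylinders over a sequence exhausting la are enough *)
have sfin : sigma_finite setT (la \x mu).
  have /sigma_finiteP[G [TG _ Goo]] := sigma_finiteT la.
  exists (fun n => G n `*` setT).
    by rewrite -setXTT TG predeqE => -[x y]; split => [[[n _ Gnx] _]|[n _ [Gnx _]]];
      [exists n|split => //; exists n].
  move=> n; have [mG Gn] := Goo n; split; first exact: measurableX.
  rewrite product_measure1E// lte_mul_pinfty ?ge0_fin_numE//.
  by rewrite -ge0_fin_numE ?measure_ge0// fin_num_measure.
pose sfinM := Measure_isSigmaFinite.Build _ _ _ (la \x mu) sfin.
pose lamu : {sigma_finite_measure set (T1 * T2)%type -> \bar R} :=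
  HB.pack (la \x mu) sfinM.
exact: (@ge0_integral_density _ _ R P lamu joint_density
  measurable_joint_density joint_density_ge0 joint_densityE h mh h0).
Qed.

Lemma ge0_integral_disintegration (h : T1 * T2 -> \bar R) :
  measurable_fun [set: T1 * T2] h -> (forall z, 0 <= h z) ->
  \int[P]_z h z = \int[mu]_(x in X) \int[la]_y (h (y, x) * (k x y)%:E).
Proof.
by move=> mh h0; rewrite ge0_integral_joint_density// iterated_joint_density.
Qed.

End disintegration.

(** * Convergence of the mixture at a fixed covariate *)

Section mixture_bounds.
Variable R : realType.

Definition bandwidth n m : R := m%:R^-1 `^ (1 / (4 * n.+1%:R)).

Lemma bandwidth_gt0 n m : (0 < m)%N -> 0 < bandwidth n m.
Proof. by move=> m0; rewrite powR_gt0// invr_gt0 ltr0n. Qed.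

Lemma bandwidthX n m : bandwidth n m ^+ (4 * n.+1) = m%:R^-1.
Proof.
rewrite /bandwidth -powR_mulrn ?powR_ge0// -powRrM natrM div1r mulVf.
  by rewrite powRr1// invr_ge0.
by rewrite mulf_neq0 ?pnatr_eq0.
Qed.

Lemma bandwidth_lt n d : 0 < d ->
  \forall m \near \oo, bandwidth n m < d.
Proof.
move=> d0; have dn0 : 0 < d ^+ (4 * n.+1) by exact: exprn_gt0.
exists (Num.bound (d ^+ (4 * n.+1))^-1).+1 => // m /= bm.
have m0 : (0 < m)%N by apply: leq_ltn_trans bm.
rewrite ltNge; apply/negP => ds.
have : d ^+ (4 * n.+1) <= m%:R^-1.
  by rewrite -(bandwidthX n) lerXn2r// nnegrE ltW// bandwidth_gt0.
have dinv : 0 <= (d ^+ (4 * n.+1))^-1 by rewrite invr_ge0 ltW.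
have := archi_boundP dinv; set N := Num.bound _ => dN.
rewrite leNgt => /negP; apply.
rewrite -[ltRHS]invrK ltf_pV2 ?posrE ?invr_gt0 ?ltr0n//.
by apply: (lt_trans dN); rewrite ltr_nat.
Qed.

(** The error of order [s ^+ (4 * n + 2)] on [p] is at most half of the lower bound
    [c * s ^+ n] of [S], hence at most half of [S], so that [p] inherits the bounds
    on [S] up to constants. *)
Lemma perturbed_bounds (n : nat) (c s B M p S g : R) :
    0 < s -> s <= 1 -> 0 <= B -> B * s <= c / 2 ->
    `|p - S| <= B * s ^+ (4 * n.+1) / s ^+ 2 ->
    c * g <= S -> c * s ^+ n <= S -> S <= M ->
  [/\ c / 2 * g <= p, p <= M + B & `|p - S| <= B * s].
Proof.
move=> s0 s1 B0 Bs pS cg cs SM.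
have {}pS : `|p - S| <= B * s * s ^+ n.
  apply: (le_trans pS).
  have -> : B * s ^+ (4 * n.+1) / s ^+ 2 = B * s * s ^+ n * (s * s ^+ (3 * n)).
    rewrite mulSn exprD exprS mulnS exprD; field.
    by rewrite gt_eqF.
  have s3 : s * s ^+ (3 * n) <= 1.
    by rewrite -exprS exprn_ile1// ltW.
  by rewrite ler_piMr// !mulr_ge0 ?exprn_ge0// ltW.
have sn0 : 0 <= s ^+ n by rewrite exprn_ge0// ltW.
have sn1 : s ^+ n <= 1 by rewrite exprn_ile1// ltW.
have pS1 : `|p - S| <= B * s.
  by apply: (le_trans pS); rewrite ler_piMr// mulr_ge0// ltW.
have pS2 : `|p - S| <= S / 2.
  apply: (le_trans pS); apply: (@le_trans _ _ (c / 2 * s ^+ n)).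
    by rewrite ler_wpM2r.
  by rewrite mulrAC; lra.
have BsB : B * s <= B by rewrite ler_piMr.
move: (pS1) pS2; rewrite !ler_norml => /andP[? ?] /andP[? ?].
by split => //; lra.
Qed.

End mixture_bounds.

(** * The conditional densities of the model *)

Section conditional_densities.
Variables (R : realType) (dx : nat) (Y : set R) (X : set 'rV[R]_dx).
Variable F : probability (measurableTypeR R * borel_rV R dx)%type R.
Variables (f : 'rV[R]_dx -> R -> R) (fmax : R).
Variables (a b a1 b1 : 'rV[R]_dx -> R) (fmin : R) (n : nat) (r : R).
Hypothesis mX : measurable (X : set (borel_rV R dx)).
Hypothesis f_density : conditional_density F Y X f.
Hypothesis f_bounded : forall x y, X x -> Y y -> f x y <= fmax.
Hypothesis f_support : forall x, X x ->
  density_support f x = `[a x, b x]%classic.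
Hypothesis fmin01 : 0 < fmin < 1.
Hypothesis a_a1_b1_b : forall x, X x ->
  [/\ a x <= a1 x, a1 x <= b1 x & b1 x <= b x].
Hypothesis f_ge_mid : forall x y, X x -> a1 x <= y <= b1 x -> fmin <= f x y.
Hypothesis f_ge_left : forall x y, X x -> a x < y < a1 x ->
  fmin * (y - a x) ^+ n <= f x y.
Hypothesis f_ge_right : forall x y, X x -> b1 x < y < b x ->
  fmin * (b x - y) ^+ n <= f x y.
Hypothesis f_nondecreasing : forall x, X x ->
  {in `]a x, (a1 x + r / 2)[ &, {homo f x : y z / y <= z}}.
Hypothesis f_nonincreasing : forall x, X x ->
  {in `](b1 x - r / 2), b x[ &, {homo f x : y z /~ y <= z}}.

Let fmin_gt0 : 0 < fmin. Proof. by case/andP: fmin01. Qed.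

Lemma conditional_density_ge0 x y : X x -> 0 <= f x y.
Proof. by move=> Xx; have [_ f0 _ _ _] := f_density; exact: f0. Qed.

Lemma measurable_conditional_density x : X x -> measurable_fun [set: R] (f x).
Proof.
move=> Xx; have [mf _ _ _ _] := f_density.
pose i (y : measurableTypeR R) : measurableTypeR R * borel_rV R dx := (y, x).
have mi : measurable_fun setT i by exact: measurable_pair2.
have mD : measurable ([set: measurableTypeR R] `*` (X : set (borel_rV R dx))).
  exact: measurableX.
have iD : i @` setT `<=` [set: measurableTypeR R] `*` (X : set (borel_rV R dx)).
  by move=> _ [y _ <-].
exact: (measurable_comp mD iD mf mi).
Qed.

(** Enlarging the bound makes it valid outside [Y], where the density vanishes,
    and larger than [fmin]. *)
Definition density_bound : R := `|fmax| + 1.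

Lemma conditional_density_le x y : X x -> f x y <= density_bound.
Proof.
move=> Xx; have [_ _ fY _ _] := f_density; rewrite /density_bound.
have [Yy|nYy] := pselect (Y y); last by rewrite fY// addr_ge0.
by apply: (le_trans (f_bounded Xx Yy)); rewrite (le_trans (ler_norm _))// lerDl.
Qed.

Let fmin_le : fmin <= density_bound.
Proof.
by case/andP: fmin01 => _ /ltW /le_trans; apply; rewrite /density_bound lerDr.
Qed.

Lemma conditional_density_int x : X x ->
  (\int[lebesgue_measure]_u (f x u)%:E = 1)%E.
Proof. by move=> Xx; have [_ _ _ fi _] := f_density; exact: fi. Qed.

Lemma conditional_density_out x y : X x -> y \notin `[a x, b x] -> f x y = 0.
Proof.
move=> Xx; apply: contraNeq => fy.
have : density_support f x y by apply: subset_closure.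
by rewrite f_support.
Qed.

Lemma conditional_density_gt0 x y : X x -> a x < y < b x -> 0 < f x y.
Proof.
move=> Xx /andP[ay yb].
have [ya1|a1y] := ltP y (a1 x).
  apply: lt_le_trans (f_ge_left Xx _); last by rewrite ay.
  by rewrite mulr_gt0// exprn_gt0// subr_gt0.
have [b1y|yb1] := ltP (b1 x) y.
  apply: lt_le_trans (f_ge_right Xx _); last by rewrite b1y.
  by rewrite mulr_gt0// exprn_gt0// subr_gt0.
by apply: (lt_le_trans fmin_gt0); apply: f_ge_mid => //; rewrite a1y.
Qed.

Lemma support_le x : X x -> a x <= b x.
Proof. by case/a_a1_b1_b => ? ? ?; lra. Qed.

Lemma quantileP p x : X x -> 0 <= p <= 1 ->
  quantile f p x \in `[a x, b x] /\ density_cdf (f x) (quantile f p x) = p.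
Proof.
move=> Xx p01.
have [t tab ct] := cdf_onto (measurable_conditional_density Xx)
  (fun y => conditional_density_ge0 y Xx) (fun y => conditional_density_le y Xx)
  (conditional_density_int Xx) (fun y => @conditional_density_out x y Xx)
  (support_le Xx) p01.
suff -> : quantile f p x = t by [].
rewrite -[RHS](inf_cdf (measurable_conditional_density Xx)
  (fun y => conditional_density_ge0 y Xx) 
  (conditional_density_int Xx) (fun y => @conditional_density_gt0 x y Xx) tab).
by rewrite /quantile f_support// ct.
Qed.

(** The end points of the support are themselves quantiles; this is how the
    continuity of the quantiles makes the support uniformly bounded. *)
Lemma quantile0 x : X x -> quantile f 0 x = a x.
Proof.
move=> Xx; have [|] := @quantileP 0 x Xx; first by rewrite lexx ler01.
rewrite in_itv/= le_eqVlt => /andP[/predU1P[//|aq qb]].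
have := lt_cdf (measurable_conditional_density Xx)
  (fun y => conditional_density_ge0 y Xx) 
  (conditional_density_int Xx) (fun y => @conditional_density_gt0 x y Xx)
  (lexx (a x)) aq qb.
rewrite (cdf_left (measurable_conditional_density Xx)
  (fun y => conditional_density_ge0 y Xx) 
  (conditional_density_int Xx) (fun y => @conditional_density_out x y Xx)).
by move=> + q0; rewrite q0 ltxx.
Qed.

Lemma quantile1 x : X x -> quantile f 1 x = b x.
Proof.
move=> Xx; have [|] := @quantileP 1 x Xx; first by rewrite lexx ler01.
rewrite in_itv/= [_ <= b x]le_eqVlt => /andP[aq /predU1P[//|qb]].
have := lt_cdf (measurable_conditional_density Xx)
  (fun y => conditional_density_ge0 y Xx) 
  (conditional_density_int Xx) (fun y => @conditional_density_gt0 x y Xx)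
  aq qb (lexx (b x)).
rewrite (cdf_right (conditional_density_int Xx) (fun y => @conditional_density_out x y Xx)).
by move=> + q1; rewrite q1 ltxx.
Qed.

Lemma mixture_estimates m (P : 'I_m -> mpoly.mpoly dx R) B :
    (0 < m)%N ->
    (forall j x, X x ->
      `|mpoly_fun (P j) x - quantile f (j.+1%:R / m%:R) x| <= m%:R^-1) ->
    (forall x, X x -> b x - a x + 1 <= B) ->
    bandwidth R n m <= 1 -> bandwidth R n m <= r / 4 ->
    B * bandwidth R n m <= smoothing_const density_bound fmin n / 2 ->
  forall x y, X x -> a x < y < b x ->
  [/\ smoothing_const density_bound fmin n / 2 * f x y <=
         normal_mixture_density P (bandwidth R n m) x y,
      normal_mixture_density P (bandwidth R n m) x y <= density_bound + B &
      `|normal_mixture_density P (bandwidth R n m) x y -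
        smooth (f x) (bandwidth R n m) y| <= B * bandwidth R n m].
Proof.
move=> m0 PQ abB s1 sr Bs x y Xx xy; have s0 := bandwidth_gt0 R n m0.
have f0 u := conditional_density_ge0 u Xx.
have fM u := conditional_density_le u Xx.
have mf := measurable_conditional_density Xx.
have fi := conditional_density_int Xx.
have [_ a1b1 _] := a_a1_b1_b Xx.
have B0 : 0 <= B by apply: le_trans (abB x Xx); have := support_le Xx; lra.
have [cf cs] := smooth_lower_bound mf f0 fM fi fmin_gt0 fmin_le a1b1
  (fun u => f_ge_mid Xx) (fun u => f_ge_left Xx) (fun u => f_ge_right Xx)
  (f_nondecreasing Xx) (f_nonincreasing Xx) s0 s1 sr xy.
apply: (perturbed_bounds s0 s1 B0 Bs _ cf cs); last exact: smooth_le.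
have qP j : (j <= m)%N -> quantile f (j%:R / m%:R) x \in `[a x, b x] /\
    density_cdf (f x) (quantile f (j%:R / m%:R) x) = j%:R / m%:R.
  move=> jm; apply: quantileP => //.
  by rewrite divr_ge0//= ler_pdivrMr ?ltr0n// mul1r ler_nat.
apply: (le_trans (mixture_smooth mf f0 fi
  (fun u => @conditional_density_out x u Xx) (fun u => @conditional_density_gt0 x u Xx)
  y s0 m0 qP (t := fun j => mpoly_fun (P j) x) _)).
  by move=> j; exact: PQ.
rewrite invfM mulrA bandwidthX ler_pM2r ?invr_gt0 ?exprn_gt0//.
by rewrite ler_pM2r ?invr_gt0 ?ltr0n// abB.
Qed.

End conditional_densities.

(** * The law of the sample under the joint distribution *)

(** For [t >= 1] use [ln t < t]; for [t < 1] use [- ln t = ln t^-1 < t^-1]. *)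
Lemma log_bound (R : realType) (M t : R) : 0 <= t -> t <= M ->
  t * `|ln t| <= 1 + M ^+ 2.
Proof.
move=> t0 tM; have [->|t_neq0] := eqVneq t 0.
  by rewrite mul0r addr_ge0// sqr_ge0.
have {t_neq0}t_gt0 : 0 < t by rewrite lt_neqAle eq_sym t_neq0.
have [t1|t1] := leP 1 t.
  rewrite ger0_norm ?ln_ge0//.
  have tln : t * ln t <= t * t by rewrite ler_pM2l// ltW// ln_sublinear.
  apply: (le_trans tln); rewrite -expr2 ler_wpDl// lerXn2r// nnegrE.
  exact: le_trans tM.
rewrite ler0_norm; last by rewrite ln_le0// ltW.
rewrite -lnV ?posrE//.
apply: (@le_trans _ _ (t * t^-1)).
  by rewrite ler_pM2l// ltW// ln_sublinear// invr_gt0.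
by rewrite divff ?gt_eqF// lerDl sqr_ge0.
Qed.

Section joint_distribution.
Variables (R : realType) (dx : nat) (Y : set R) (X : set (borel_rV R dx)).
Local Notation T := (measurableTypeR R * borel_rV R dx)%type.
Variable F : probability T R.
Variables (f : 'rV[R]_dx -> R -> R) (M : R) (a b : 'rV[R]_dx -> R).
Hypothesis mX : measurable (X : set (borel_rV R dx)).
Hypothesis f_density : conditional_density F Y X f.
Hypothesis f_leM : forall x y, X x -> f x y <= M.
Hypothesis f_out : forall x y, X x -> y \notin `[a x, b x] -> f x y = 0.
Hypothesis ma : measurable_fun X (a : borel_rV R dx -> measurableTypeR R).
Hypothesis mb : measurable_fun X (b : borel_rV R dx -> measurableTypeR R).

Let covariate : {mfun T >-> borel_rV R dx} :=
  HB.pack (snd : T -> borel_rV R dx)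
    (isMeasurableFun.Build _ _ _ _ (snd : T -> borel_rV R dx) measurable_snd).

Let marginal : probability (borel_rV R dx) R := distribution F covariate.

Let f_ge0 x y : X x -> 0 <= f x y.
Proof. by move=> Xx; have [_ f0 _ _ _] := f_density; exact: f0. Qed.

Let FE (B : set (measurableTypeR R)) (C : set (borel_rV R dx)) :
  measurable B -> measurable C ->
  F (B `*` C) = (\int[marginal]_(x in X `&` C)
     \int[lebesgue_measure]_(y in B) (f x y)%:E)%E.
Proof. by move=> mB mC; have [_ _ _ _] := f_density; exact. Qed.

Let mf : measurable_fun (setT `*` X) (fun z : T => f z.2 z.1).
Proof. by have [] := f_density. Qed.

Definition inner_region : set T := [set z | X z.2 /\ a z.2 < z.1 < b z.2].

Lemma measurable_inner_region : measurable inner_region.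
Proof.
have mD : measurable ([set: measurableTypeR R] `*` (X : set (borel_rV R dx))).
  exact: measurableX.
have m1 : measurable_fun (setT `*` X) (fst : T -> measurableTypeR R).
  exact: measurable_funTS.
have m2 (c : borel_rV R dx -> measurableTypeR R) : measurable_fun X c ->
    measurable_fun (setT `*` X) (c \o (snd : T -> borel_rV R dx)).
  move=> mc; apply: (measurable_comp mX _ mc); last exact: measurable_funTS.
  by move=> _ [z [_ Xz] <-].
have := measurable_and (measurable_fun_ltr (m2 _ ma) m1) (measurable_fun_ltr m1 (m2 _ mb)).
move=> /(_ mD [set true]) /(_ _).
rewrite (_ : _ `&` _ = inner_region); first by apply.
apply/seteqP; split => z /=.
  by move=> [[_ Xz] zab]; split.
by move=> [Xz zab]; split.
Qed.

(** For fixed [x], the density vanishes outside the closed support, whose two end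
    points form a Lebesgue null set. *)
Lemma joint_law_inner_region : {ae F, forall z, X z.2 -> inner_region z}.
Proof.
have mD : measurable ([set: measurableTypeR R] `*` (X : set (borel_rV R dx))).
  exact: measurableX.
pose N := ([set: measurableTypeR R] `*` (X : set (borel_rV R dx))) `\` inner_region.
have mN : measurable N by apply: measurableD => //; exact: measurable_inner_region.
exists N; split => //; last first.
  by move=> z /= /not_implyP[Xz nz]; split.
rewrite -[N]setIT -integral_indic//.
rewrite (ge0_integral_disintegration mX mf f_ge0 FE); last 2 first.
- by apply/measurable_EFinP; exact: measurable_indic.
- by move=> z; rewrite lee_fin.
apply: integral0_eq => x Xx.
pose e : set R := [set a x; b x].
have me : lebesgue_measure.-negligible e.
  apply: negligibleU; apply/negligibleP => //; exact: lebesgue_measure_set1.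
apply: etrans (integral0 lebesgue_measure setT).
apply: ge0_ae_eq_integral => //.
- apply: emeasurable_funM; apply/measurable_EFinP.
    pose i (y : measurableTypeR R) : T := (y, x).
    have mi : measurable_fun setT i by exact: measurable_pair2.
    exact: (measurableT_comp (measurable_indic mN) mi).
  exact: (measurable_conditional_density mX f_density Xx).
- by move=> y _; rewrite mule_ge0// lee_fin ?f_ge0.
apply: negligibleS me => y /= /not_implyP[_].
apply: contra_notP => /not_orP[ya yb].
have [yab|/(f_out Xx)->] := boolP (y \in `[a x, b x]); last by rewrite mule0.
rewrite indicE memNset ?mul0e// => -[_]; apply; split => //=.
move: yab; rewrite in_itv/= !le_eqVlt => /andP[/predU1P[/esym//|ay]].
by move=> /predU1P[//|yb']; rewrite ay.
Qed.

(** Under the joint law [`|ln f|] is integrated against [f], and [f * `|ln f|] is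
    bounded on a box of finite measure outside of which [f] vanishes. *)
Lemma integrable_log_density A (D : set T) C : measurable D ->
    D `<=` [set z | X z.2] ->
    (forall x, X x -> `|a x| <= A /\ `|b x| <= A) -> 0 <= C ->
  F.-integrable D (fun z => (C + 2 * `|ln (f z.2 z.1)|)%:E).
Proof.
move=> mD DX abA C0.
have [x0 Xx0] : exists x, X x.
  apply: contrapT => /forallNP nX.
  have := probability_setT F; rewrite -setXTT FE// => /eqP.
  rewrite (_ : X `&` _ = set0) ?integral_set0 ?eqe ?oner_eq0 1?eq_sym ?oner_eq0//.
  by rewrite setIT; apply/seteqP; split => // x /nX.
have A0 : 0 <= A by have [aA _] := abA _ Xx0; exact: le_trans aA.
have M0 : 0 <= M by exact: le_trans (f_ge0 0 Xx0) (f_leM 0 Xx0).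
pose D' := [set: measurableTypeR R] `*` X.
have mD' : measurable D' by exact: measurableX.
pose g (z : T) := C + 2 * `|ln (f z.2 z.1)|.
have g0 z : 0 <= g z by rewrite addr_ge0// mulr_ge0.
have mg : measurable_fun D' g.
  apply: measurable_funD => //; apply: measurable_funM => //.
  apply: measurableT_comp => //; exact: measurableT_comp mf.
suff : F.-integrable D' (EFin \o g).
  apply: integrableS => //; by move=> z /DX; split.
apply/integrableP; split; first exact/measurable_EFinP.
under eq_integral => z _ do rewrite gee0_abs ?lee_fin ?g0//.
rewrite integral_mkcond.
set h := (_ \_ _).
have mh : measurable_fun setT h.
  by apply/(measurable_restrictT _ _).1 => //; exact/measurable_EFinP.
have h0 z : (0 <= h z)%E.
  by rewrite /h patchE; case: ifPn => // _; rewrite lee_fin g0.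
rewrite (ge0_integral_joint_density mX mf f_ge0 FE mh h0).
pose K := C * M + 2 * (1 + M ^+ 2).
have K0 : 0 <= K by rewrite addr_ge0// mulr_ge0// addr_ge0// sqr_ge0.
pose box : set T := `[-A, A]%classic `*` setT.
have mbox : measurable box by exact: measurableX.
apply: (@le_lt_trans _ _
  (\int[lebesgue_measure \x marginal]_z (K%:E * (\1_box z)%:E))%E).
  apply: ge0_le_integral => //.
  - by move=> z _; rewrite mule_ge0// joint_density_ge0.
  - by apply: emeasurable_funM => //; exact: measurable_joint_density.
  - apply: emeasurable_funM => //; apply/measurable_EFinP.
    exact: measurable_indic.
  move=> [y x] _; rewrite /joint_density/= !patchE.
  case: ifPn => [|_]; last first.
    by rewrite mule0 -EFinM lee_fin mulr_ge0.
  rewrite inE => -[/= _ Xx].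
  have [yab|/(f_out Xx)->] := boolP (y \in `[a x, b x]); last first.
    by rewrite mule0 -EFinM lee_fin mulr_ge0.
  rewrite indicE mem_set; last first.
    split => //=; move: yab; rewrite !in_itv/=; have [] := abA _ Xx.
    by rewrite !ler_norml => /andP[? ?] /andP[? ?] /andP[? ?]; apply/andP; split; lra.
  rewrite mule1 /h patchE mem_set//= -EFinM lee_fin /g /K mulrDl -mulrA.
  rewrite lerD//; first by rewrite ler_wpM2l// f_leM.
  rewrite ler_pM2l// mulrC; apply: log_bound; first exact: f_ge0.
  exact: f_leM.
rewrite ge0_integralZl//; last first.
  by apply/measurable_EFinP; exact: measurable_indic.
rewrite lte_mul_pinfty ?lee_fin// integral_indic// setIT.
have mI : measurable (`[-A, A]%classic : set (measurableTypeR R)) by [].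
have boxE := @product_measure1E _ _ _ _ R lebesgue_measure marginal _ _ mI
  (@measurableT _ (borel_rV R dx)).
apply: (le_lt_trans (y := lebesgue_measure (`[-A, A]%classic : set R))).
  have mar1 : marginal [set: borel_rV R dx] = 1%E by exact: probability_setT.
  by rewrite -[leRHS]mule1 -mar1 -boxE.
rewrite lebesgue_measure_itv/=; case: ifP => _; last exact: ltry.
by rewrite -EFinB ltry.
Qed.

(** Dominated convergence: [c * f <= p <= K] yields
    [`|ln (f / p)| <= `|ln c| + `|ln K| + 2 * `|ln f|]. *)
Lemma kl_divergence_cvg0 (p : nat -> 'rV[R]_dx -> R -> R) A c K :
    measurable (Y : set (measurableTypeR R)) ->
    (forall m, measurable_fun [set: T] (fun z => p m z.2 z.1)) ->
    (forall m x y, 0 < p m x y) ->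
    (forall x, X x -> `|a x| <= A /\ `|b x| <= A) ->
    (forall x y, X x -> a x < y < b x -> 0 < f x y) ->
    0 < c ->
    (forall m x y, X x -> a x < y < b x -> c * f x y <= p m x y <= K) ->
    (forall x y, X x -> a x < y < b x -> p ^~ x ^~ y @ \oo --> f x y) ->
  (fun m => kl_divergence F Y X f (p m)) @ \oo --> 0%E.
Proof.
move=> mY mp p0 abA f_gt0 c0 pcK pf.
pose D : set T := Y `*` X.
have mD : measurable D by exact: measurableX.
have DX : D `<=` [set z | X z.2] by move=> z [].
pose u m (z : T) : \bar R := (ln (f z.2 z.1 / p m z.2 z.1))%:E.
have mu m : measurable_fun D (u m).
  apply/measurable_EFinP; apply: measurableT_comp => //.
  (* the inverse of the positive function p is expR (- ln p) *)
  rewrite (_ : (fun z => _) = (fun z : T => f z.2 z.1 * expR (- ln (p m z.2 z.1)))).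
    apply: measurable_funM.
      by apply: measurable_funS mf => //; [exact: measurableX|move=> z []].
    apply: measurable_funTS; apply: measurableT_comp => //.
    by apply: measurableT_comp => //; exact: measurableT_comp (mp m).
  by apply/funext => z; rewrite expRN lnK ?posrE.
have C0 : 0 <= `|ln c| + `|ln K| by exact: addr_ge0.
have ae_cvg : {ae F, forall z, D z -> u ^~ z @ \oo --> cst 0%E z}.
  apply: filterS joint_law_inner_region => z inz Dz.
  have [Xz zab] := inz (DX _ Dz).
  have fz := f_gt0 _ _ Xz zab.
  suff h : (fun m => ln (f z.2 z.1 / p m z.2 z.1)) @ \oo --> ln 1.
    by apply: cvg_EFin; [near=> m|rewrite -[X in _ --> X]ln1; exact: h].
  have {1}<- : f z.2 z.1 / f z.2 z.1 = 1 by rewrite divff ?gt_eqF.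
  apply: (@continuous_cvg _ _ _ _ _ _ (@ln R)).
    by apply: continuous_ln; rewrite divr_gt0.
  by apply: cvgM; [exact: cvg_cst|apply: cvgV; [rewrite gt_eqF|exact: pf]].
have ae_dom : {ae F, forall z m, D z ->
    (`|u m z| <= (`|ln c| + `|ln K| + 2 * `|ln (f z.2 z.1)|)%:E)%E}.
  apply: filterS joint_law_inner_region => z inz m Dz.
  have [Xz zab] := inz (DX _ Dz).
  have fz := f_gt0 _ _ Xz zab; have /andP[cp pK] := pcK m _ _ Xz zab.
  have pz := p0 m z.2 z.1.
  rewrite lee_fin ln_div ?posrE//.
  have l1 : ln c + ln (f z.2 z.1) <= ln (p m z.2 z.1).
    by rewrite -lnM ?posrE// ler_ln ?posrE// mulr_gt0.
  have l2 : ln (p m z.2 z.1) <= ln K.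
    by rewrite ler_ln ?posrE// (lt_le_trans pz).
  have n1 := ler_norm (- ln c); rewrite normrN in n1.
  have n2 := ler_norm (ln K).
  have n3 := ler_norm (ln (f z.2 z.1)).
  have n4 := ler_norm (- ln (f z.2 z.1)); rewrite normrN in n4.
  have n5 := normr_ge0 (ln c); have n6 := normr_ge0 (ln K).
  by rewrite ler_norml; apply/andP; split; lra.
have [_ _] := dominated_convergence mD mu (measurable_cst _) ae_cvg
  (integrable_log_density mD DX abA C0) ae_dom.
by rewrite integral0.
Unshelve. all: by end_near. Qed.

End joint_distribution.

(** * The normal mixtures *)

Section mixture_measurability.
Variables (R : realType) (dx : nat).
Local Notation T := (measurableTypeR R * borel_rV R dx)%type.

Lemma measurable_continuous_rV (g : 'rV[R]_dx -> R) : continuous g ->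
  measurable_fun [set: borel_rV R dx] (g : borel_rV R dx -> measurableTypeR R).
Proof.
move=> /continuousP cg; apply: (measurability _ (RGenOpens.measurableE R)).
move=> _ [_ [u [v ->] <-]]; rewrite setTI; apply: sub_sigma_algebra.
by apply: cg; exact: interval_open.
Qed.

Lemma normal_mixture_density_gt0 m (P : 'I_m -> mpoly.mpoly dx R) s x y :
  (0 < m)%N -> 0 < s -> 0 < normal_mixture_density P s x y.
Proof.
case: m P => // m P _ s0; rewrite /normal_mixture_density.
have pos j : 0 < m.+1%:R^-1 *
    normal_pdf (mpoly.meval (fun i => x ord0 i) (P j)) s y.
  rewrite mulr_gt0 ?invr_gt0// normal_pdf_gauss// mulr_gt0 ?gauss_gt0//.
  by rewrite divr_gt0// gauss_peak_gt0.
by rewrite big_ord_recl ltr_pwDl// sumr_ge0// => j _; exact: ltW.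
Qed.

Lemma measurable_normal_mixture_density m (P : 'I_m -> mpoly.mpoly dx R) s :
  0 < s ->
  measurable_fun [set: T] (fun z => normal_mixture_density P s z.2 z.1).
Proof.
move=> s0; apply: measurable_sum => j; apply: measurable_funM => //.
rewrite (_ : (fun z => _) = fun z : T =>
    gauss_peak R / s * gauss ((z.1 - mpoly_fun (P j) z.2) / s)); last first.
  by apply/funext => z; rewrite normal_pdf_gauss.
have mgauss : measurable_fun setT (@gauss R).
  apply: measurableT_comp => //=; apply: measurable_funM => //=.
  apply: measurableT_comp => //=; exact: measurable_funX.
apply: measurable_funM => //; apply: measurableT_comp mgauss _.
apply: measurable_funM => //; apply: measurable_funB => //.
exact: measurableT_comp (measurable_continuous_rV
  (@continuous_mpoly_fun R dx (P j))) measurable_snd.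
Qed.

End mixture_measurability.

(** * Convergence of the divergence *)

Theorem corollary5p2 (R : realType) (dx : nat)
    (Y : set R) (X : set 'rV[R]_dx)
    (mY : measurable (Y : set (measurableTypeR R)))
    (mX : measurable (X : set (borel_rV R dx)))
    (F : probability (measurableTypeR R * borel_rV R dx)%type R)
    (F_YX : F (Y `*` X) = 1%E)
    (nu : {measure set (borel_rV R dx) -> \bar R}) (fX : 'rV[R]_dx -> R)
    (fX_density : marginal_density F X nu fX)
    (f : 'rV[R]_dx -> R -> R)
    (f_density : conditional_density F Y X f)
    (f_cont : forall (x : 'rV[R]_dx) (y : R), X x -> (density_support f x)° y ->
      {for y, continuous (f x)})
    (fmax : R)
    (f_bounded : forall (x : 'rV[R]_dx) (y : R), X x -> Y y -> f x y <= fmax)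
    (a b a1 b1 : 'rV[R]_dx -> R) (fmin : R) (n : nat)
    (f_support : forall x : 'rV[R]_dx, X x -> density_support f x = `[a x, b x]%classic)
    (a_sqint : square_integrable F X a)
    (b_sqint : square_integrable F X b)
    (fmin01 : 0 < fmin < 1)
    (n_gt0 : (0 < n)%N)
    (a_a1_b1_b : forall x : 'rV[R]_dx, X x -> [/\ a x <= a1 x, a1 x <= b1 x & b1 x <= b x])
    (f_ge_mid : forall (x : 'rV[R]_dx) (y : R), X x -> a1 x <= y <= b1 x -> fmin <= f x y)
    (f_ge_left : forall (x : 'rV[R]_dx) (y : R), X x -> a x < y < a1 x ->
      fmin * (y - a x) ^+ n <= f x y)
    (f_ge_right : forall (x : 'rV[R]_dx) (y : R), X x -> b1 x < y < b x ->
      fmin * (b x - y) ^+ n <= f x y)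
    (r : R) (r_gt0 : 0 < r)
    (f_nondecreasing : forall x : 'rV[R]_dx, X x ->
      {in `]a x, (a1 x + r / 2)[ &, {homo f x : y z / y <= z}})
    (f_nonincreasing : forall x : 'rV[R]_dx, X x ->
      {in `](b1 x - r / 2), b x[ &, {homo f x : y z /~ y <= z}})
    (quantile_cont : forall p : R, 0 <= p <= 1 ->
      {within X, continuous (quantile f p)})
    (X_compact : compact X) :
  exists P : forall m : nat, 'I_m -> mpoly.mpoly dx R,
    (fun m : nat => kl_divergence F Y X f
       (normal_mixture_density (P m)
          (m%:R^-1 `^ (1 / (4 * (n.+1)%:R))))) @ \oo --> 0%E.
Proof.
have approx m (j : 'I_m) : exists p : mpoly.mpoly dx R, forall x, X x ->
    `|mpoly_fun p x - quantile f (j.+1%:R / m%:R) x| <= m%:R^-1.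
  case: m j => [[]//|m] j.
  apply: continuous_mpoly_approximable => //.
  by apply: quantile_cont; rewrite divr_ge0//= ler_pdivrMr// mul1r ler_nat.
pose P m j := sval (cid (approx m j)).
have PP m j : forall x, X x ->
    `|mpoly_fun (P m j) x - quantile f (j.+1%:R / m%:R) x| <= m%:R^-1.
  by rewrite /P; case: cid.
exists P.
have bounded (g : 'rV[R]_dx -> R) p : 0 <= p <= 1 ->
    (forall x, X x -> quantile f p x = g x) ->
    exists A, forall x, X x -> `|g x| <= A.
  move=> p01 gE; have := continuous_compact (quantile_cont p p01) X_compact.
  move=> /compact_bounded[N [_ NB]]; exists (`|N| + 1) => x Xx.
  rewrite -gE//; apply: (NB (`|N| + 1)); last by exists x.
  by rewrite (le_lt_trans (ler_norm N))// ltrDl.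
have [A aA] := bounded a 0 ltac:(by rewrite lexx ler01)
  (quantile0 mX f_density f_bounded f_support fmin01 a_a1_b1_b f_ge_mid f_ge_left f_ge_right).
have [A' bA] := bounded b 1 ltac:(by rewrite lexx ler01)
  (quantile1 mX f_density f_bounded f_support fmin01 a_a1_b1_b f_ge_mid f_ge_left f_ge_right).
pose c := smoothing_const (density_bound fmax) fmin n.
have c0 : 0 < c.
  apply: smoothing_const_gt0; first by case/andP: fmin01.
  by case/andP: fmin01 => _ /ltW/le_trans; apply; rewrite /density_bound lerDr.
pose B := `|A| + `|A'| + 1.
have B0 : 0 < B by rewrite ltr_pwDr// addr_ge0.
have abB x : X x -> b x - a x + 1 <= B.
  move=> Xx; have := aA x Xx; have := bA x Xx.
  have := ler_norm A; have := ler_norm A'; rewrite /B !ler_norml.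
  by move=> ? ? /andP[? ?] /andP[? ?]; lra.
(* all the bounds hold as soon as the bandwidth is below d *)
pose d := Num.min 1 (Num.min (r / 4) (c / 2 / B)).
have d0 : 0 < d by rewrite !lt_min ltr01 !divr_gt0.
have [N _ Nd] := bandwidth_lt n d0.
have small m : bandwidth R n (m + N.+1) < d.
  by apply: Nd => /=; rewrite addnS ltnW// ltnS leq_addl.
have pos m : (0 < m + N.+1)%N by rewrite addnS.
pose p m := normal_mixture_density (P (m + N.+1)%N) (bandwidth R n (m + N.+1)).
have est m x y : X x -> a x < y < b x ->
    [/\ c / 2 * f x y <= p m x y, p m x y <= density_bound fmax + B &
      `|p m x y - smooth (f x) (bandwidth R n (m + N.+1)) y| <=
      B * bandwidth R n (m + N.+1)].
  move: x y; have := small m; rewrite !lt_min => /and3P[s1 sr sB].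
  apply: (mixture_estimates mX f_density f_bounded f_support fmin01 a_a1_b1_b
    f_ge_mid f_ge_left f_ge_right f_nondecreasing f_nonincreasing (pos m)
    (@PP _) abB (ltW s1) (ltW sr)).
  by rewrite mulrC -ler_pdivlMr// ltW.
rewrite -(cvg_shiftn N.+1).
apply: (@kl_divergence_cvg0 R dx Y X F f (density_bound fmax) a b mX f_density _ _
  a_sqint.1 b_sqint.1 p (`|A| + `|A'|) (c / 2) (density_bound fmax + B)) => //.
- by move=> x y Xx; exact: (conditional_density_le f_density f_bounded).
- by move=> x y Xx; exact: (conditional_density_out f_support).
- by move=> m; apply: measurable_normal_mixture_density; exact: bandwidth_gt0.
- by move=> m x y; apply: normal_mixture_density_gt0 => //; exact: bandwidth_gt0.
- move=> x Xx; have := aA x Xx; have := bA x Xx.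
  have := ler_norm A; have := ler_norm A'.
  have := normr_ge0 A; have := normr_ge0 A'.
  by move=> ? ? ? ? ? ?; split; lra.
- by move=> x y Xx; exact: (conditional_density_gt0 fmin01 f_ge_mid f_ge_left f_ge_right).
- by rewrite divr_gt0.
- by move=> m x y Xx xy; have [-> ->] := est m x y Xx xy.
move=> x y Xx xy; apply/cvgrPdist_le => e e0.
have e2 : 0 < e / 2 by rewrite divr_gt0.
have cont : {for y, continuous (f x)}.
  apply: f_cont => //; rewrite f_support//.
  have : y \in `]a x, b x[ by rewrite in_itv.
  move=> /near_in_itvoo; apply: filterS => u; exact: subset_itv_oo_cc.
have [h h0 hP] := smooth_cvg (measurable_conditional_density mX f_density Xx)
  (fun u => conditional_density_ge0 f_density u Xx)
  (fun u => conditional_density_le f_density f_bounded u Xx)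
  (conditional_density_int f_density Xx) cont e2.
have hB0 : 0 < Num.min h (e / 2 / B) by rewrite lt_min h0 divr_gt0.
have [N' _ N'd] := bandwidth_lt n hB0.
exists N' => // m /= N'm.
have : bandwidth R n (m + N.+1) < Num.min h (e / 2 / B).
  by apply: N'd => /=; exact: leq_trans (leq_addr _ _).
rewrite lt_min => /andP[mh mB].
have [_ _ pS] := est m x y Xx xy.
have := hP _ (bandwidth_gt0 R n (pos m)) mh.
have {mB} mB : B * bandwidth R n (m + N.+1) <= e / 2.
  by rewrite mulrC -ler_pdivlMr// ltW.
move: (le_trans pS mB); rewrite !ler_norml.
by move=> /andP[? ?] /andP[? ?]; apply/andP; split; lra.
Qed.
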